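(* Let $N \ge 1$ be an integer, let $p=1<\theta$, and consider the system $$-\Delta u = v, \qquad -\Delta v = u^\theta \qquad \text{in } \mathbb{R}^N. \tag{S}$$ Suppose $$N < 2 + \frac{4(\theta+1)}{\theta-1}\, t_0^+ .$$ Then there is no positive stable solution $(u,v)$ of (S). In particular, if $N \le 10$, there is no positive stable solution of (S) for any $\theta>1$.
   Context: With $p=1$ put $z = \frac{2\theta}{\theta+1}$ (this is $\frac{p\theta(p+1)}{\theta+1}$ with $p=1$) and define $$t_0^+ = \sqrt{z} + \sqrt{z-\sqrt{z}} .$$ A positive solution of (S) is a pair $(u,v)$ of smooth functions on $\mathbb{R}^N$ with $u>0$, $v>0$ everywhere, satisfying the equations pointwise (so $\Delta^2 u = u^\theta$ and $v=-\Delta u$). Such a solution is called stable if there exist smooth functions $\zeta>0$ and $\chi>0$ on $\mathbb{R}^N$ with $$-\Delta \zeta = \chi, \qquad -\Delta \chi = \theta\, u^{\theta-1}\zeta \qquad \text{in } \mathbb{R}^N.$$ *)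

(* Defs.v *)
From mathcomp Require Export all_boot all_order all_algebra.
From mathcomp Require Export all_classical all_reals all_analysis.
Export Order.TTheory GRing.Theory Num.Theory.
Export numFieldNormedType.Exports.

Set Implicit Arguments.
Unset Strict Implicit.
Unset Printing Implicit Defensive.

Local Open Scope classical_set_scope.
Local Open Scope ring_scope.

(* [R^N] is ['rV[R]_N]; its library norm is the sup norm, which has the same
   topology, hence the same smooth functions, as the Euclidean one. *)

Definition evec (R : realType) (N : nat) (i : 'I_N) : 'rV[R]_N :=
  delta_mx 0 i.

Definition partial (R : realType) (N : nat) (i : 'I_N) (f : 'rV[R]_N -> R)
  : 'rV[R]_N -> R := fun x => 'D_(evec R i) f x.

Fixpoint is_Ck (R : realType) (N k : nat) (f : 'rV[R]_N -> R) : Prop :=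
  match k with
  | 0 => continuous f
  | k'.+1 => continuous f /\
      forall i : 'I_N,
        (forall x, derivable f x (evec R i)) /\ is_Ck k' (partial i f)
  end.

Definition smooth (R : realType) (N : nat) (f : 'rV[R]_N -> R) : Prop :=
  forall k : nat, is_Ck k f.

Definition laplacian (R : realType) (N : nat) (f : 'rV[R]_N -> R)
  : 'rV[R]_N -> R := fun x => \sum_(i < N) partial i (partial i f) x.

(* [`^] is the power with a real exponent; it is the usual one here, since its
   base [u x] is positive. *)
Definition positive_solution (R : realType) (N : nat) (theta : R)
    (u v : 'rV[R]_N -> R) : Prop :=
  [/\ smooth u, smooth v,
      (forall x, 0 < u x /\ 0 < v x),
      (forall x, - laplacian u x = v x)
    & (forall x, - laplacian v x = u x `^ theta)].

(* Linearizing [- laplacian u = v] gives the first equation for [zeta], [chi],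
   so [v] itself does not occur in the condition. *)
Definition stable (R : realType) (N : nat) (theta : R)
    (u v : 'rV[R]_N -> R) : Prop :=
  exists zeta chi : 'rV[R]_N -> R,
    [/\ smooth zeta, smooth chi,
        (forall x, 0 < zeta x /\ 0 < chi x),
        (forall x, - laplacian zeta x = chi x)
      & (forall x, - laplacian chi x = theta * u x `^ (theta - 1) * zeta x)].

Definition zparam (R : realType) (theta : R) : R :=
  2 * theta / (theta + 1).

(* For [1 < theta] one has [1 < zparam theta], so both radicands are positive and
   the convention [Num.sqrt x = 0] for [x < 0] plays no role. *)
Definition t0plus (R : realType) (theta : R) : R :=
  Num.sqrt (zparam theta)
  + Num.sqrt (zparam theta - Num.sqrt (zparam theta)).

(* Main.v *)
Require Import Defs.
From mathcomp Require Import ring lra.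

(** The proof rests on the divergence of a single vector field on the cube
    [-1,1]^N, vanishing on its faces.  Write s = (theta+1)/2 and a = s^(-1/2).

    1. Pointwise comparison.  The function w = a u^s - v satisfies
       Lap w >= a s u^(s-1) w.  Where w > 0 one has u^s >= w/a, so
       Lap w >= c w^(1+d) with d = (s-1)/s > 0; a Keller-Osserman argument
       ([superlinear_bound]) bounds w(0) by a constant depending only on theta
       and N, and rescaling the solution forces w <= 0, that is a u^s <= v
       ([comparison]).

    2. Integral estimate.  Fix q = 2t >= 2 and a cutoff g with values in [0,1].
       Three vector fields are combined.
       - (grad zeta/zeta + grad chi/chi)/2 * v^q g^M: by stability its divergence
         is at most - sqrt theta u^(s-1) v^q g^M + |grad (v^t g^(M/2))|^2.
       - v^(q-1) g^M grad v: through -Lap v = u^theta <= u^(s-1) v / a it controls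
         the gradient term above by lam u^(s-1) v^q g^M / a, and this is absorbed
         as soon as t^2 < lam (q-1) and lam < a sqrt theta.  Such a lam exists
         exactly when t^2/(2t-1) < a sqrt theta = sqrt z, which holds
         for sqrt z <= t < t_0^+.
       - u grad W - W grad u with W = v^(q-1) g^(M-2): as -Lap u = v, it controls
         the cutoff errors v^q g^(M-2) by u^(theta+1) v^(q-2) g^(M-2) and terms
         with a factor u/v.  The convexity condition q >= 2 gives the term
         |grad v|^2 its good sign.
       Let rho = u/v.  By the comparison rho <= C v^(-d).  If rho <= eps g^2 the
       errors are absorbed; if rho > eps g^2 then v^d g^2 is bounded, hence so are
       the errors, provided the power of g is large ([absorption],
       [weight_bounds]).  Thus no bootstrap is needed: the divergence of a single
       field is at most K - kap u^(s-1) v^q g^m on the cube, with constants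
       that do not depend on the solution ([energy_field]).

    3. Conclusion.  The integral of a divergence vanishes, so the integral of
       u^(s-1) v^q g^m over the cube is bounded uniformly over all stable
       solutions.  For the solution rescaled by L this integral is at least
       c L^(2 + (4/(theta-1) + 2) q - N), which is unbounded in L under the
       hypothesis on N ([no_stable_solution]).

    The only integration that occurs is the divergence theorem for a field whose
    normal component vanishes on the faces of a cube.  It is proved directly with
    Riemann sums over a grid ([divergence_bound]): difference quotients telescope
    along the grid, and uniform continuity replaces them by partial derivatives.
*)

Set Implicit Arguments.
Unset Strict Implicit.
Unset Printing Implicit Defensive.

Local Open Scope classical_set_scope.
Local Open Scope ring_scope.

(** * Calculus along a direction *)

Lemma powRDr (R : realType) (x r s : R) : 0 < x -> x `^ (r + s) = x `^ r * x `^ s.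
Proof. by move=> x0; rewrite powRD // (gt_eqF x0) implybT. Qed.

Lemma continuous_at_powR (R : realType) (a x : R) : 0 < x ->
  {for x, continuous (fun y : R => y `^ a)}.
Proof.
move=> x0; have [dp _] := is_derive1_powR a x0.
exact/differentiable_continuous/derivable1_diffP.
Qed.

Section Calculus.
Context {R : realType} {V : normedModType R}.
Implicit Types (e x : V) (f g : V -> R).

(** Directional derivatives reduce to derivatives of functions of one real
    variable, for which the chain rule and the mean value theorem are available. *)
Lemma is_derive_line f e x (t d : R) :
  is_derive (x + t *: e) e f d -> is_derive t 1 (fun s => f (x + s *: e)) d.
Proof.
have E : (fun h : R => h^-1 *: (((fun s => f (x + s *: e)) \o shift t) (h *: 1)
           - f (x + t *: e))) =
    (fun h => h^-1 *: ((f \o shift (x + t *: e)) (h *: e) - f (x + t *: e))).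
  apply/funext => h /=; congr (_ *: (f _ - _)).
  by rewrite [h *: 1]mulr1 scalerDl addrCA addrA addrC addrA addrAC.
case=> df <-; apply: DeriveDef; first by rewrite /derivable E.
by rewrite /derive E.
Qed.

Lemma is_derive_of_line f e x (d : R) :
  is_derive (0 : R) 1 (fun s => f (x + s *: e)) d -> is_derive x e f d.
Proof.
have E : (fun h : R => h^-1 *: (((fun s => f (x + s *: e)) \o shift 0) (h *: 1)
           - f (x + 0 *: e))) =
    (fun h => h^-1 *: ((f \o shift x) (h *: e) - f x)).
  apply/funext => h /=; rewrite scale0r; congr (_ *: (f _ - f _)).
    by rewrite [h *: 1]mulr1 addr0 addrC.
  by rewrite addr0.
case=> df dE; apply: DeriveDef; first by move: df; rewrite /derivable E.
by move: dE; rewrite /derive E.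
Qed.

Lemma is_derive_comp_real (h : R -> R) f e x (d d' : R) :
  is_derive (f x) 1 h d' -> is_derive x e f d ->
  is_derive x e (fun y => h (f y)) (d' * d).
Proof.
move=> hd fd; apply: is_derive_of_line.
apply: (@is_derive1_comp R h (fun s : R => f (x + s *: e))).
  by rewrite scale0r addr0.
by apply: is_derive_line; rewrite scale0r addr0.
Qed.

(** The derivative is carried as an explicit function, so that the rules below
    compute it and propagate its continuity. *)
Definition C1_along e f f' : Prop :=
  [/\ continuous f, continuous f' & forall x, is_derive x e f (f' x)].

Lemma C1_along_ext e f f' g g' : C1_along e f f' -> f =1 g -> f' =1 g' ->
  C1_along e g g'.
Proof. by move=> H /funext <- /funext <-. Qed.

Lemma C1_along_cst e (c : R) : C1_along e (fun=> c) (fun=> 0).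
Proof.
by split; [exact: cst_continuous|exact: cst_continuous|move=> x; exact: is_derive_cst].
Qed.

Lemma C1_alongD e f f' g g' : C1_along e f f' -> C1_along e g g' ->
  C1_along e (fun x => f x + g x) (fun x => f' x + g' x).
Proof.
move=> [cf cf' df] [cg cg' dg]; split=> x.
- exact: cvgD (cf x) (cg x).
- exact: cvgD (cf' x) (cg' x).
- exact: is_deriveD.
Qed.

Lemma C1_alongM e f f' g g' : C1_along e f f' -> C1_along e g g' ->
  C1_along e (fun x => f x * g x) (fun x => f x * g' x + g x * f' x).
Proof.
move=> [cf cf' df] [cg cg' dg]; split=> x.
- exact: cvgM (cf x) (cg x).
- exact: cvgD (cvgM (cf x) (cg' x)) (cvgM (cg x) (cf' x)).
- exact: is_deriveM.
Qed.

Lemma C1_alongZ e (c : R) f f' : C1_along e f f' ->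
  C1_along e (fun x => c * f x) (fun x => c * f' x).
Proof.
move=> H; apply: C1_along_ext (C1_alongM (C1_along_cst e c) H) _ _ => // x.
by rewrite mulr0 addr0.
Qed.

Lemma C1_along_comp e f f' (h h' : R -> R) (A : set R) :
  (forall y, A y -> is_derive y 1 h (h' y) /\ {for y, continuous h'}) ->
  (forall x, A (f x)) -> C1_along e f f' ->
  C1_along e (fun x => h (f x)) (fun x => h' (f x) * f' x).
Proof.
move=> hA fA [cf cf' df]; split=> x.
- apply: continuous_comp; first exact: cf.
  have [[dh _] _] := hA _ (fA x).
  exact/differentiable_continuous/derivable1_diffP.
- apply: continuousM; last exact: cf'.
  by apply: continuous_comp; [exact: cf|exact: (hA _ (fA x)).2].
- exact: is_derive_comp_real (hA _ (fA x)).1 (df x).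
Qed.

Lemma C1_along_powR e (a : R) f f' : (forall x, 0 < f x) -> C1_along e f f' ->
  C1_along e (fun x => f x `^ a) (fun x => a * f x `^ (a - 1) * f' x).
Proof.
move=> f0; apply: (@C1_along_comp e f f' (@powR R ^~ a)
  (fun y => a * y `^ (a - 1)) (fun y => 0 < y)) => // y y0; split.
  exact: is_derive1_powR.
apply: continuousM; first exact: cst_continuous.
exact: continuous_at_powR.
Qed.

Lemma C1_alongV e f f' : (forall x, 0 < f x) -> C1_along e f f' ->
  C1_along e (fun x => (f x)^-1) (fun x => - (f x) ^- 2 * f' x).
Proof.
move=> f0; apply: (@C1_along_comp e f f' (fun y => y^-1)
  (fun y => - y ^- 2) (fun y => 0 < y)) => // y y0; have yN0 : y != 0 by rewrite gt_eqF.
split.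
  by have := is_deriveV yN0 (is_derive_id y 1); rewrite [_ *: 1]mulr1.
apply: continuousN; apply: continuousV; last exact: exprn_continuous.
by rewrite sqrf_eq0.
Qed.

Lemma C1_alongX e n f f' : C1_along e f f' ->
  C1_along e (fun x => f x ^+ n) (fun x => n%:R * f x ^+ n.-1 * f' x).
Proof.
apply: (@C1_along_comp e f f' (fun y => y ^+ n)
  (fun y => n%:R * y ^+ n.-1) setT) => // y _; split.
  split; first exact: exprn_derivable.
  by rewrite exp_derive -[RHS]mulr1.
apply: continuousM; first exact: cst_continuous.
exact: exprn_continuous.
Qed.

Lemma increment_mean e x f f' (h : R) : C1_along e f f' -> 0 < h ->
  exists2 t, 0 < t < h & f (x + h *: e) - f x = f' (x + t *: e) * h.
Proof.
move=> [_ _ df] h0.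
have cl : continuous (fun s : R => f (x + s *: e)).
  move=> s; have [dl _] := is_derive_line (df (x + s *: e)).
  exact/differentiable_continuous/derivable1_diffP.
have [||t] := @MVT R (fun s => f (x + s *: e)) (fun s => f' (x + s *: e)) 0 h h0.
- by move=> s _; apply: is_derive_line.
- exact: continuous_subspaceT.
by rewrite in_itv /= scale0r addr0 subr0 => th ?; exists t.
Qed.

End Calculus.

(** * Divergence theorem on a cube *)

Section Divergence.
Context {R : realType} {N : nat}.
Implicit Types (x : 'rV[R]_N) (i : 'I_N).

Definition cube : set 'rV[R]_N := [set x | forall i, -1 <= x ord0 i <= 1].

Lemma compact_cube : compact cube.
Proof.
exact: @rV_compact R N (fun=> `[-1, 1]%classic) (fun=> @segment_compact R (-1) 1).
Qed.

(** Heine's theorem, in the only form needed: uniformity of a small translation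
    along a fixed vector. *)
Lemma uniform_translation (f : 'rV[R]_N -> R) (e : 'rV[R]_N) (A : set 'rV[R]_N)
    (eps : R) : continuous f -> compact A -> 0 < eps ->
  \forall s \near (0 : R), forall x, A x -> `|f (x + s *: e) - f x| < eps.
Proof.
move=> cf cA eps0.
apply: ((compact_near_coveringP A).1 cA R (nbhs (0 : R))
  (fun s x => `|f (x + s *: e) - f x| < eps)) => x Ax.
have cg : (fun z : 'rV[R]_N * R => f (z.1 + z.2 *: e) - f z.1) @ (x, 0 : R) --> (0 : R).
  have fx0 : f (x + 0 *: e) - f x = 0 by rewrite scale0r addr0 subrr.
  rewrite -[X in _ --> X]fx0.
  have cpt : (fun z : 'rV[R]_N * R => z.1 + z.2 *: e) @ (x, 0 : R) --> x + 0 *: e.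
    by apply: cvgD; [exact: cvg_fst|apply: cvgZ; [exact: cvg_snd|exact: cvg_cst]].
  have c1 : (fun z : 'rV[R]_N * R => f (z.1 + z.2 *: e)) @ (x, 0 : R) --> f (x + 0 *: e).
    exact: cvg_comp cpt (cf _).
  have c2 : (fun z : 'rV[R]_N * R => f z.1) @ (x, 0 : R) --> f x.
    have cfst : (fun z : 'rV[R]_N * R => z.1) @ (x, 0 : R) --> x by exact: cvg_fst.
    exact: cvg_comp cfst (cf x).
  exact: (cvgB c1 c2).
by move/cvgr0Pnorm_lt: cg => /(_ _ eps0).
Qed.

Lemma increment_ge (f f' : 'rV[R]_N -> R) e x (h eps : R) :
  C1_along e f f' -> 0 < h ->
  (forall s, 0 <= s <= h -> `|f' (x + s *: e) - f' x| < eps) ->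
  f (x + h *: e) - f x <= h * (f' x + eps).
Proof.
move=> C1 h0 H; have [t /andP[t0 th] ->] := increment_mean x C1 h0.
rewrite mulrC ler_wpM2l ?(ltW h0) //.
have := H t; rewrite (ltW t0) (ltW th) => /(_ isT).
by rewrite ltr_norml; lra.
Qed.

(** Step 1/(k+1) along each axis; the faces x_i = 1 are left out, because the
    grid is going to be rotated cyclically. *)
Definition grid (k : nat) (j : {ffun 'I_N -> 'I_(k.+1).*2}) : 'rV[R]_N :=
  \row_i (-1 + (j i)%:R / k.+1%:R).

Definition rotate (k : nat) i (j : {ffun 'I_N -> 'I_(k.+1).*2}) :
    {ffun 'I_N -> 'I_(k.+1).*2} :=
  [ffun i' => if i' == i then ordS (j i') else j i'].

Lemma rotate_bij k i : bijective (@rotate k i).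
Proof.
exists (fun j : {ffun 'I_N -> 'I_(k.+1).*2} =>
  [ffun i' => if i' == i then ord_pred (j i') else j i']) => j;
  apply/ffunP => i'; rewrite !ffunE; case: eqP => // _;
  by rewrite ?ordSK ?ord_predK.
Qed.

Lemma grid_cube k j : cube (@grid k j).
Proof.
move=> i; rewrite mxE.
have k0 : 0 < k.+1%:R :> R by rewrite ltr0n.
rewrite lerDl divr_ge0 ?ler0n //= -lerBrDl ler_pdivrMr //.
rewrite (_ : 1 - -1 = 2%:R) -?natrM; last by lra.
by rewrite ler_nat mul2n ltnW.
Qed.

(** Stepping forward along axis i agrees with a cyclic rotation of the indices,
    even at the last index: there F vanishes on both faces.  The rotation being
    a bijection, forward differences of F have sum zero. *)
Lemma grid_shift k (F : 'rV[R]_N -> R) i j :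
  (forall x, x ord0 i = -1 \/ x ord0 i = 1 -> F x = 0) ->
  F (@grid k j + k.+1%:R^-1 *: evec R i) = F (grid (rotate i j)).
Proof.
move=> F0; have [ji|ji] := ltnP (j i).+1 (k.+1).*2.
  congr F; apply/rowP => i'; rewrite !mxE !ffunE eqxx /=.
  case: eqVneq => [->|_]; last by rewrite mulr0 addr0.
  by rewrite /= modn_small // mulr1 -addrA -[(j i).+1%:R]natr1 mulrDl mul1r.
have {}ji : (j i).+1 = (k.+1).*2 by apply/eqP; rewrite eqn_leq ji ltn_ord.
have k0 : k.+1%:R != 0 :> R by rewrite pnatr_eq0.
rewrite !F0 //; [left|right]; rewrite !mxE ?ffunE eqxx /=.
  by rewrite ji modnn mul0r addr0.
have -> : (j i)%:R = 2 * k.+1%:R - 1 :> R.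
  have : (j i).+1%:R = 2 * k.+1%:R :> R by rewrite ji -natrM mul2n.
  by rewrite -natr1 => <-; rewrite addrK.
by field.
Qed.

Lemma card_grid k : #|{: {ffun 'I_N -> 'I_k}}| = (k ^ N)%N.
Proof. by rewrite card_ffun !card_ord. Qed.

Lemma grid_sum_derivative_ge (F F' : 'rV[R]_N -> R) i k (eps : R) :
  C1_along (evec R i) F F' ->
  (forall x, x ord0 i = -1 \/ x ord0 i = 1 -> F x = 0) ->
  (forall x s, cube x -> 0 <= s <= k.+1%:R^-1 ->
     `|F' (x + s *: evec R i) - F' x| < eps) ->
  - eps * ((k.+1).*2 ^ N)%:R <= \sum_j F' (@grid k j).
Proof.
move=> dF F0 H; set h : R := k.+1%:R^-1.
have h0 : 0 < h by rewrite invr_gt0 ltr0n.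
have tele : \sum_j (F (@grid k j + h *: evec R i) - F (grid j)) = 0.
  rewrite sumrB; apply/eqP; rewrite subr_eq0; apply/eqP.
  under eq_bigr do rewrite grid_shift //.
  by rewrite [RHS](reindex (@rotate k i)) //=; exact/onW_bij/rotate_bij.
have : 0 <= \sum_j h * (F' (@grid k j) + eps).
  rewrite -[leLHS]tele; apply: ler_sum => j _.
  by apply: increment_ge => // s; apply: H; exact: grid_cube.
rewrite -mulr_sumr pmulr_rge0 // big_split /= sumr_const card_grid -mulr_natr.
lra.
Qed.

(** The grid points with coordinates in [0, 1/(l+1)[ are a fixed proportion of
    the grid, as k+1 is a multiple of l+1. *)
Lemma corner_sum_ge (G : 'rV[R]_N -> R) (c : R) k l m : k.+1 = (l.+1 * m)%N ->
  (forall x, cube x -> 0 <= G x) ->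
  (forall x, (forall i, 0 <= x ord0 i <= l.+1%:R^-1) -> c <= G x) ->
  c * (m ^ N)%:R <= \sum_j G (@grid k j).
Proof.
move=> kE G0 Gc.
have lt j : (j < m -> k.+1 + j < k.+1.*2)%N.
  by move=> jm; rewrite -addnn ltn_add2l kE (leq_trans jm) // leq_pmull.
pose f (j : {ffun 'I_N -> 'I_m}) : {ffun 'I_N -> 'I_k.+1.*2} :=
  [ffun i => Ordinal (lt _ (ltn_ord (j i)))].
have finj : injective f.
  move=> j1 j2 /ffunP jj; apply/ffunP => i; apply/val_inj.
  by have := jj i; rewrite !ffunE => /(congr1 val) /= /addnI.
rewrite (bigID (mem (f @: setT))) /=.
apply: ler_wpDr; first by apply: sumr_ge0 => j _; exact/G0/grid_cube.
rewrite big_imset /=; last by move=> ? ? _ _; exact: finj.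
rewrite mulr_natr -(card_grid m) -sumr_const big_mkcond /= [leRHS]big_mkcond /=.
apply: ler_sum => j _; rewrite in_setT; apply: Gc => i.
rewrite mxE ffunE /= natrD mulrDl divff ?pnatr_eq0 // addrA addNr add0r.
rewrite divr_ge0 //= kE natrM invfM mulrCA ler_pdivrMl ?ltr0n //.
rewrite mulfV ?pnatr_eq0 //.
have m0 : 0 < m%:R :> R by rewrite ltr0n (leq_ltn_trans _ (ltn_ord (j i))).
by rewrite ler_pdivrMr // mul1r ler_nat ltnW.
Qed.

(** Divided by the number of grid points, the sum of the divergence is at least
    - N eps, the sum of G at least c / (2 (l+1))^N; then eps tends to 0. *)
Lemma divergence_bound (F F' : 'I_N -> 'rV[R]_N -> R) (G : 'rV[R]_N -> R)
    (K c : R) (l : nat) :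
  (forall i, C1_along (evec R i) (F i) (F' i)) ->
  (forall i x, x ord0 i = -1 \/ x ord0 i = 1 -> F i x = 0) ->
  (forall x, cube x -> \sum_i F' i x <= K - G x) ->
  (forall x, cube x -> 0 <= G x) ->
  (forall x, (forall i, 0 <= x ord0 i <= l.+1%:R^-1) -> c <= G x) ->
  c <= K * (2 * l.+1%:R) ^+ N.
Proof.
move=> dF F0 divF G0 Gc; set D := (2 * l.+1%:R) ^+ N.
have D0 : 0 < D by rewrite exprn_gt0 // mulr_gt0 // ltr0n.
apply/ler_addgt0Pr => e e0.
pose eps := e / (N.+1%:R * D).
have eps0 : 0 < eps by rewrite divr_gt0 // mulr_gt0 // ltr0n.
have near_i i : \forall s \near (0 : R), forall x, cube x ->
    `|F' i (x + s *: evec R i) - F' i x| < eps.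
  apply: uniform_translation eps0; last exact: compact_cube.
  by have [] := dF i.
have : \forall s \near (0 : R), forall i x, cube x ->
    `|F' i (x + s *: evec R i) - F' i x| < eps by exact: filter_forall near_i.
move=> /nbhs_ballP[d /= d0 near_d].
pose m := Num.truncn d^-1.
have md : m.+1%:R^-1 < d.
  by rewrite invf_plt ?posrE ?ltr0n // truncnS_gt.
pose k := (l.+1 * m.+1).-1.
have kE : k.+1 = (l.+1 * m.+1)%N by [].
have sumF' : - (N%:R * eps * (k.+1.*2 ^ N)%:R) <= \sum_(j : {ffun 'I_N -> 'I_k.+1.*2}) \sum_i F' i (grid j).
  rewrite exchange_big /= (_ : - _ = \sum_(i < N) - eps * (k.+1.*2 ^ N)%:R); last first.
    by rewrite sumr_const card_ord -mulr_natr; ring.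
  apply: ler_sum => i _.
  apply: grid_sum_derivative_ge => [|x|x s cx /andP[s0 sk]]; [exact: dF|exact: F0|].
  suff sd : ball (0 : R) d s by exact: (near_d s sd i x cx).
  rewrite /ball /= sub0r normrN ger0_norm //.
  apply: le_lt_trans sk _; apply: le_lt_trans md.
  by rewrite lef_pV2 ?posrE ?ltr0n // ler_nat kE leq_pmull.
have sumG := corner_sum_ge kE G0 Gc.
have sumK : \sum_(j : {ffun 'I_N -> 'I_k.+1.*2}) \sum_i F' i (grid j)
    <= K * (k.+1.*2 ^ N)%:R - \sum_j G (@grid k j).
  rewrite mulr_natr -(card_grid k.+1.*2) -sumr_const -sumrB.
  by apply: ler_sum => j _; apply: divF; exact: grid_cube.
have M0 : 0 < (m.+1 ^ N)%:R :> R by rewrite ltr0n expn_gt0.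
have cardE : (k.+1.*2 ^ N)%:R = D * (m.+1 ^ N)%:R :> R.
  by rewrite /D !natrX -exprMn -mul2n kE !natrM mulrA.
have : c * (m.+1 ^ N)%:R <= (K + N%:R * eps) * (D * (m.+1 ^ N)%:R).
  by rewrite -cardE; lra.
rewrite mulrA ler_pM2r // mulrDl => /le_trans; apply; rewrite lerD2l.
have -> : N%:R * eps * D = e * (N%:R / N.+1%:R).
  by rewrite /eps; field; rewrite (gt_eqF D0) addrC natr1 pnatr_eq0.
rewrite ger_pMr // ler_pdivrMr ?ltr0n // mul1r ler_nat //.
Qed.

End Divergence.

(** * A polynomial cutoff *)

(** For directions in which f is affine; the difference quotient is constant. *)
Lemma is_derive_affine (R : realType) (V : normedModType R) (f : V -> R)
    (e x : V) (c : R) :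
  (forall h : R, f (h *: e + x) = f x + h * c) -> is_derive x e f c.
Proof.
move=> fh.
have lim : (fun h : R => h^-1 *: ((f \o shift x) (h *: e) - f x)) @ 0^' --> c.
  apply: cvg_near_cst; near=> h.
  rewrite /= fh addrC addKr; apply: mulKf; near: h; exact: nbhs_dnbhs_neq.
apply: DeriveDef; first by apply/cvg_ex; exists c.
exact/cvg_lim.
Unshelve. all: by end_near. Qed.

Section Cutoff.
Context {R : realType} {N : nat}.
Implicit Types (x : 'rV[R]_N) (i : 'I_N).

Lemma C1_along_coord i j :
  C1_along (evec R i) (fun x => x ord0 j) (fun=> (j == i)%:R).
Proof.
split; [exact: coord_continuous|exact: cst_continuous|move=> x].
apply: is_derive_affine => h.
by rewrite !mxE eqxx /= addrC eq_sym.
Qed.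

Lemma C1_along_prod0 i (r : seq 'I_N) (P : pred 'I_N)
    (f : 'I_N -> 'rV[R]_N -> R) :
  (forall j, P j -> C1_along (evec R i) (f j) (fun=> 0)) ->
  C1_along (evec R i) (fun x => \prod_(j <- r | P j) f j x) (fun=> 0).
Proof.
move=> Pf; elim: r => [|j r IH].
  by apply: C1_along_ext (C1_along_cst (evec R i) 1) _ _ => // x; rewrite big_nil.
have [Pj|Pj] := boolP (P j).
  apply: C1_along_ext (C1_alongM (Pf j Pj) IH) _ _ => x.
    by rewrite big_cons Pj.
  by rewrite !mulr0 addr0.
by apply: C1_along_ext IH _ _ => // x; rewrite big_cons (negbTE Pj).
Qed.

Definition cutoff_rest i x : R := \prod_(j | j != i) (1 - x ord0 j ^+ 2).

(** Vanishing on the faces of the cube suffices for the divergence theorem, so a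
    polynomial does, and it is smooth on the whole space. *)
Definition cutoff x : R := \prod_j (1 - x ord0 j ^+ 2).

Definition cutoff1 i x : R := - 2 * x ord0 i * cutoff_rest i x.

Definition cutoff2 i x : R := - 2 * cutoff_rest i x.

Lemma continuous_cutoff : continuous cutoff.
Proof.
rewrite /cutoff; elim: (index_enum _) => [|j r IH] x.
  rewrite (_ : (fun y => _) = cst 1); first exact: cst_continuous.
  by apply/funext => y; rewrite big_nil.
rewrite (_ : (fun y : 'rV[R]_N => _) =
    fun y : 'rV[R]_N => (1 - y ord0 j ^+ 2) * \prod_(l <- r) (1 - y ord0 l ^+ 2)).
  apply: cvgM (IH x); apply: cvgB; first exact: cvg_cst.
  exact: cvg_comp (@coord_continuous R 1 N ord0 j x) (@exprn_continuous R 2 _).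
by apply/funext => y; rewrite big_cons.
Qed.

Lemma cutoffE i x : cutoff x = (1 - x ord0 i ^+ 2) * cutoff_rest i x.
Proof. by rewrite /cutoff (bigD1 i). Qed.

Lemma C1_along_bump i j : C1_along (evec R i) (fun x => 1 - x ord0 j ^+ 2)
  (fun x => - 2 * x ord0 j * (j == i)%:R).
Proof.
apply: C1_along_ext (C1_alongD (C1_along_cst _ 1)
  (C1_alongZ (-1) (C1_alongX 2 (C1_along_coord i j)))) _ _ => x /=; first by ring.
by move: ((j == i)%:R : R) => b; ring.
Qed.

Lemma C1_along_cutoff_rest i : C1_along (evec R i) (cutoff_rest i) (fun=> 0).
Proof.
apply: C1_along_prod0 => j ji.
apply: C1_along_ext (C1_along_bump i j) _ _ => // x.
by rewrite (negbTE ji) mulr0.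
Qed.

Lemma C1_along_cutoff i : C1_along (evec R i) cutoff (cutoff1 i).
Proof.
apply: C1_along_ext (C1_alongM (C1_along_bump i i) (C1_along_cutoff_rest i)) _ _ => x.
  by rewrite (cutoffE i).
by rewrite /cutoff1 eqxx mulr1; ring.
Qed.

Lemma C1_along_cutoff1 i : C1_along (evec R i) (cutoff1 i) (cutoff2 i).
Proof.
apply: C1_along_ext (C1_alongM (C1_alongZ (-2) (C1_along_coord i i))
  (C1_along_cutoff_rest i)) _ _ => x.
  by [].
by rewrite /cutoff2 eqxx mulr1; ring.
Qed.

Lemma cutoff_face i x : x ord0 i = -1 \/ x ord0 i = 1 -> cutoff x = 0.
Proof. by rewrite (cutoffE i) => -[] ->; ring. Qed.

Lemma bump_bounds (t : R) : -1 <= t <= 1 -> 0 <= 1 - t ^+ 2 <= 1.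
Proof. by move=> /andP[? ?]; apply/andP; split; nra. Qed.

Lemma cutoff_rest_bounds i x : cube x -> 0 <= cutoff_rest i x <= 1.
Proof.
move=> cx; apply/andP; split.
  by apply: prodr_ge0 => j _; have /andP[] := bump_bounds (cx j).
by apply: prodr_ile1 => j _; exact: bump_bounds.
Qed.

Lemma cutoff_bounds x : cube x -> 0 <= cutoff x <= 1.
Proof.
move=> cx; apply/andP; split.
  by apply: prodr_ge0 => j _; have /andP[] := bump_bounds (cx j).
by apply: prodr_ile1 => j _; exact: bump_bounds.
Qed.

Lemma cutoff1_bounds i x : cube x -> `|cutoff1 i x| <= 2.
Proof.
move=> cx; rewrite /cutoff1 !normrM normrN normr_nat -mulrA ger_pMr //.
have /andP[r0 r1] := cutoff_rest_bounds i cx.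
have x1 : `|x ord0 i| <= 1 by rewrite ler_norml; exact: cx.
by rewrite (ger0_norm r0) mulr_ile1.
Qed.

Lemma cutoff2_bounds i x : cube x -> -2 <= cutoff2 i x <= 0.
Proof.
by move=> /(cutoff_rest_bounds i) /andP[r0 r1]; rewrite /cutoff2; apply/andP; split; lra.
Qed.

Lemma cutoff_corner x : (forall i, 0 <= x ord0 i <= 2^-1) ->
  (2^-1) ^+ N <= cutoff x.
Proof.
move=> x1; rewrite -[X in _ ^+ X](card_ord N) -prodr_const.
apply: ler_prod => i _; have /andP[? ?] := x1 i.
by apply/andP; split; nra.
Qed.

Lemma cutoff0 : cutoff 0 = 1.
Proof. by rewrite /cutoff big1 // => i _; rewrite mxE expr0n /= subr0. Qed.

End Cutoff.

(** * Rescaling *)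

Section Rescaling.
Context {R : realType} {N : nat}.
Implicit Types (x : 'rV[R]_N) (i : 'I_N) (f : 'rV[R]_N -> R).

Lemma smooth_C1_along i f : smooth f -> C1_along (evec R i) f (partial i f).
Proof.
move=> /(_ 1%N) /= [cf /(_ i) [df cdf]]; by split.
Qed.

Lemma smooth_partial i f : smooth f -> smooth (partial i f).
Proof. by move=> sf k; have /= [_ /(_ i) []] := sf k.+1. Qed.

Definition zoom (c L : R) (x0 : 'rV[R]_N) f x : R := c * f (x0 + L *: x).

Lemma is_derive_zoom c L x0 f (e x : 'rV[R]_N) d :
  is_derive (x0 + L *: x) e f d -> is_derive x e (zoom c L x0 f) (c * L * d).
Proof.
move=> fd; apply: is_derive_of_line.
rewrite (_ : (fun s => _) =
    c *: ((fun s => f ((x0 + L *: x) + s *: e)) \o (fun s : R => L * s))); last first.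
  by apply/funext => s /=; rewrite /zoom scalerDr addrA scalerA.
rewrite -mulrA; apply: is_deriveZ; rewrite mulrC; apply: is_derive1_comp.
  by apply: is_derive_line; rewrite mulr0 scale0r addr0.
by have := is_deriveZ L (is_derive_id (0 : R) 1); rewrite [_ *: 1]mulr1.
Qed.

Lemma partial_zoom c L x0 i f : (forall x, derivable f x (evec R i)) ->
  partial i (zoom c L x0 f) = zoom (c * L) L x0 (partial i f).
Proof.
move=> df; apply/funext => x.
by have [_] := @is_derive_zoom c L x0 f (evec R i) x _ (derivableP (df _)).
Qed.

Lemma is_Ck_zoom k c L x0 f : is_Ck k f -> is_Ck k (zoom c L x0 f).
Proof.
have cz g c' : continuous g -> continuous (zoom c' L x0 g).
  move=> cg x; rewrite /continuous_at /zoom.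
  have ca : (fun y => x0 + L *: y) @ x --> x0 + L *: x.
    exact: cvgD (cvg_cst _) (cvgZl_tmp (k := L) (@cvg_id _ (nbhs x))).
  have cga : (fun y => g (x0 + L *: y)) @ x --> g (x0 + L *: x).
    exact: cvg_comp ca (cg _).
  exact: (cvgM (cvg_cst c') cga).
elim: k c f => [|k IH] c f /=; first exact: cz.
move=> [cf df]; split; first exact: cz.
move=> i; have [dif Ckf] := df i; split.
  by move=> x; have [] := @is_derive_zoom c L x0 f (evec R i) x _ (derivableP (dif _)).
by rewrite partial_zoom //; exact: IH.
Qed.

Lemma smooth_zoom c L x0 f : smooth f -> smooth (zoom c L x0 f).
Proof. by move=> sf k; exact: is_Ck_zoom. Qed.

Lemma smooth_derivable i f x : smooth f -> derivable f x (evec R i).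
Proof. by move=> /(_ 1%N) /= [_ /(_ i) []]. Qed.

Lemma laplacian_zoom c L x0 f : smooth f ->
  laplacian (zoom c L x0 f) = zoom (c * L ^+ 2) L x0 (laplacian f).
Proof.
move=> sf; apply/funext => x; rewrite /laplacian /zoom mulr_sumr.
apply: eq_bigr => i _; rewrite partial_zoom; last by move=> y; exact: smooth_derivable.
rewrite partial_zoom; last by move=> y; apply: smooth_derivable; exact: smooth_partial.
by rewrite /zoom expr2 mulrA.
Qed.

Definition scaling_exponent (theta : R) : R := 4 / (theta - 1).

Section Solution.
Context (theta : R) (theta1 : 1 < theta) (u v : 'rV[R]_N -> R).
Context (x0 : 'rV[R]_N) (L : R) (L0 : 0 < L).

Let uL := zoom (L `^ scaling_exponent theta) L x0 u.
Let vL := zoom (L `^ (scaling_exponent theta + 2)) L x0 v.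

Let thetaB1 : theta - 1 != 0. Proof. by rewrite subr_eq0 gt_eqF. Qed.

Let powRLD a (n : nat) : L `^ (a + n%:R) = L `^ a * L ^+ n.
Proof. by rewrite powRD ?powR_mulrn ?ltW // (gt_eqF L0) implybT. Qed.

(** The exponents 4/(theta-1) and 4/(theta-1) + 2 are those that balance both
    equations of the system. *)
Lemma positive_solution_zoom :
  positive_solution theta u v -> positive_solution theta uL vL.
Proof.
move=> [su sv uv0 Du Dv]; split; try exact: smooth_zoom.
- by move=> x; have [? ?] := uv0 (x0 + L *: x); rewrite !mulr_gt0 ?powR_gt0.
- by move=> x; rewrite laplacian_zoom // /vL /zoom -mulrN Du powRLD.
move=> x; have [u0 _] := uv0 (x0 + L *: x).
rewrite laplacian_zoom // /uL /zoom -mulrN Dv powRM ?powR_ge0 ?ltW //.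
rewrite -powRrM -powRLD; congr (_ `^ _ * _).
by rewrite /scaling_exponent; field.
Qed.

Lemma stable_zoom : (forall x, 0 < u x) -> stable theta u v -> stable theta uL vL.
Proof.
move=> u0 [zeta [chi [sz sc zc0 Dz Dc]]].
exists (zoom 1 L x0 zeta), (zoom (L ^+ 2) L x0 chi); split; try exact: smooth_zoom.
- by move=> x; have [? ?] := zc0 (x0 + L *: x); rewrite !mulr_gt0 ?exprn_gt0.
- by move=> x; rewrite laplacian_zoom // /zoom mul1r -mulrN Dz.
move=> x; rewrite laplacian_zoom // /uL /zoom -mulrN Dc powRM ?powR_ge0 ?ltW //.
rewrite -powRrM (_ : scaling_exponent theta * (theta - 1) = 0 + 4%:R); last first.
  by rewrite /scaling_exponent; field.
by rewrite powRLD powRr0; ring.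
Qed.

End Solution.
End Rescaling.

(** * Keller-Osserman estimate and the comparison of u and v *)

Section SecondOrder.
Context {R : realType} {V : normedModType R}.

(** If f2 x > 0 then f1 is positive just after x, where it starts from 0, and two
    applications of the mean value theorem make f increase. *)
Lemma second_order_max (e x : V) (f f1 f2 : V -> R) (d : R) :
  C1_along e f f1 -> C1_along e f1 f2 -> 0 < d ->
  (forall s, `|s| < d -> f (x + s *: e) <= f x) ->
  f1 x = 0 /\ f2 x <= 0.
Proof.
move=> C1 C2 d0 fmax.
have df (s : R) : is_derive s 1 (fun s : R => f (x + s *: e)) (f1 (x + s *: e)).
  by apply: is_derive_line; case: C1.
have in_d (s : R) : (s \in `]- d, d[%R) = (`|s| < d) by rewrite in_itv /= ltr_norml.
have f1x : f1 x = 0.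
  have d0' : is_derive (0 : R) 1 (fun s : R => f (x + s *: e)) 0.
    apply: (@derive1_at_max R _ (- d) d); rewrite ?in_d ?normr0 //; first by lra.
    by move=> s; rewrite in_d scale0r addr0; exact: fmax.
  by have [_ <-] := d0'; have [_ ->] := df 0; rewrite scale0r addr0.
split=> //; rewrite leNgt; apply/negP => f2x.
have [_ cf2 _] := C2.
have c2 : (fun s : R => f2 (x + s *: e)) @ (0 : R) --> f2 x.
  have cl : (fun s : R => x + s *: e) @ (0 : R) --> x + (0 : R) *: e.
    exact: cvgD (cvg_cst x) (cvgZr_tmp (a := e) (@cvg_id _ (nbhs (0 : R)))).
  rewrite scale0r addr0 in cl; exact: cvg_comp cl (cf2 x).
have : \forall s \near (0 : R), 0 < f2 (x + s *: e) by exact: cvgr_gt c2 _ f2x.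
move=> /nbhs_ballP[r /= r0 near_r].
pose h := Num.min (r / 2) (d / 2).
have h0 : 0 < h by rewrite lt_min; lra.
have hr : h < r by rewrite gt_min; lra.
have hd : h < d by rewrite gt_min; lra.
have f2pos s : 0 < s < h -> 0 < f2 (x + s *: e).
  move=> /andP[s0 sh]; apply: near_r.
  by rewrite /ball /= sub0r normrN gtr0_norm //; lra.
have [t /andP[t0 th] Ef] := increment_mean x C1 h0.
have [t' /andP[t'0 t't] Ef1] := increment_mean x C2 t0.
have := fmax h; rewrite gtr0_norm // => /(_ hd).
rewrite -subr_le0 Ef pmulr_lle0 // leNgt => /negP; apply.
move: Ef1; rewrite f1x subr0 => ->.
by rewrite mulr_gt0 // f2pos // t'0 (lt_trans t't th).
Qed.

End SecondOrder.

Section Comparison.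
Context {R : realType} {N : nat}.
Implicit Types (x : 'rV[R]_N) (i : 'I_N).

Lemma cube_interior_ball x i : cube x -> -1 < x ord0 i < 1 ->
  exists2 d, 0 < d & forall s, `|s| < d -> cube (x + s *: evec R i).
Proof.
move=> cx /andP[xm xp]; exists (Num.min (x ord0 i + 1) (1 - x ord0 i)).
  by rewrite lt_min; lra.
move=> s; rewrite lt_min !ltr_norml => /andP[/andP[? ?] /andP[? ?]] j.
rewrite !mxE /=; have [->|_] := eqVneq j i; last by rewrite mulr0 addr0; exact: cx.
by rewrite mulr1; apply/andP; split; lra.
Qed.

(** First and second order conditions at a maximum of w g^(k+2): eliminating the
    first derivative a of w bounds its second derivative b by C w / g^2. *)
Lemma product_max_second (w a b g g1 g2 : R) (k : nat) :
  0 < w -> 0 < g <= 1 -> `|g1| <= 2 -> -2 <= g2 <= 0 ->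
  w * (k.+2%:R * g ^+ k.+1 * g1) + g ^+ k.+2 * a = 0 ->
  (w * (k.+2%:R * g ^+ k.+1 * g2 + g1 * (k.+2%:R * (k.+1%:R * g ^+ k * g1)))
    + (k.+2%:R * g ^+ k.+1 * g1) * a)
    + (g ^+ k.+2 * b + a * (k.+2%:R * g ^+ k.+1 * g1)) <= 0 ->
  b * g ^+ 2 <= (4 * k.+2%:R * (k.+3%:R) + 2 * k.+2%:R) * w.
Proof.
move=> w0 /andP[g0 gle1] g1le /andP[g2m g2p] H1 H2.
have gk0 : 0 < g ^+ k by rewrite exprn_gt0.
have k2 : 0 < k.+2%:R :> R by rewrite ltr0n.
have k3 : k.+3%:R = k.+2%:R + 1 :> R by rewrite natr1.
have k1 : k.+1%:R = k.+2%:R - 1 :> R by rewrite -[k.+2%:R]natr1 addrK.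
have ag : g * a = - k.+2%:R * w * g1.
  have gg0 : g ^+ k * g != 0 by rewrite mulf_neq0 ?gt_eqF.
  apply: (mulfI gg0); apply/eqP; rewrite -subr_eq0; apply/eqP.
  by rewrite -[RHS]H1 !exprS; ring.
have {}H2 : g ^+ k * (b * g ^+ 2 + 2 * k.+2%:R * g1 * (g * a)
     + w * (k.+2%:R * g * g2 + k.+2%:R * k.+1%:R * g1 ^+ 2)) <= 0.
  apply: le_trans H2; rewrite le_eqVlt; apply/orP; left; apply/eqP.
  by rewrite !exprS; ring.
have {H2}: b * g ^+ 2 + 2 * k.+2%:R * g1 * (g * a)
     + w * (k.+2%:R * g * g2 + k.+2%:R * k.+1%:R * g1 ^+ 2) <= 0.
  by rewrite -(pmulr_rle0 _ gk0).
rewrite ag k1 k3; move: (k.+2%:R : R) k2 => K K0 H2.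
have g1s : g1 ^+ 2 <= 4.
  by move: g1le; rewrite ler_norml => /andP[? ?]; nra.
have gg2 : - (g * g2) <= 2.
  have : 0 <= g * (g2 + 2) by apply: (mulr_ge0 (ltW g0)); lra.
  by lra.
have Kw := ltW (mulr_gt0 K0 w0).
have P1 : K * w * (K + 1) * (4 - g1 ^+ 2) >= 0.
  by apply: mulr_ge0; [apply: (mulr_ge0 Kw)|]; lra.
have P2 : K * w * (2 + g * g2) >= 0 by apply: (mulr_ge0 Kw); lra.
by lra.
Qed.

(** Keller-Osserman: at a positive maximum of w g^(k+2) the Laplacian of w is at
    most C w / g^2 but at least c w^(1+d), so w^d g^2 is bounded there, and
    (k+2) d >= 2 turns this into a bound of the maximum, hence of w 0. *)
Lemma superlinear_bound (c d : R) : 0 < c -> 0 < d ->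
  exists B : R, forall (w : 'rV[R]_N -> R) (w1 w2 : 'I_N -> 'rV[R]_N -> R),
    (forall i, C1_along (evec R i) w (w1 i)) ->
    (forall i, C1_along (evec R i) (w1 i) (w2 i)) ->
    continuous w ->
    (forall x, 0 < w x -> c * w x `^ (1 + d) <= \sum_i w2 i x) ->
    w 0 <= B.
Proof.
move=> c0 d0; pose k := (Num.truncn (2 / d)).+1.
have kd : 2 <= k.+2%:R * d.
  rewrite -ler_pdivrMr //; apply/ltW/(lt_trans (truncnS_gt _)).
  by rewrite ltr_nat.
pose M : R := N%:R * (4 * k.+2%:R * k.+3%:R + 2 * k.+2%:R) / c.
exists (Num.max 0 (M `^ d^-1)) => w w1 w2 C1 C2 cw Dw.
pose h x := w x * cutoff x ^+ k.+2.
have C1h i := C1_alongM (C1 i) (C1_alongX k.+2 (C1_along_cutoff i)).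
have C2h i := C1_alongD
  (C1_alongM (C1 i) (C1_alongM (C1_alongZ k.+2%:R (C1_alongX k.+1 (C1_along_cutoff i)))
    (C1_along_cutoff1 i)))
  (C1_alongM (C1_alongX k.+2 (C1_along_cutoff i)) (C2 i)).
have ch : continuous h.
  move=> x.
  have cg : (fun y : 'rV[R]_N => cutoff y ^+ k.+2) @ x --> cutoff x ^+ k.+2.
    apply: (@continuous_comp _ _ _ cutoff (fun y : R => y ^+ k.+2)).
      exact: continuous_cutoff.
    exact: exprn_continuous.
  exact: cvgM (cw x) cg.
have [x /set_mem cx hmax] : exists2 x, x \in cube & forall y, y \in cube -> h y <= h x.
  apply: compact_EVT_max; [|exact: compact_cube|exact: continuous_subspaceT].
  by exists 0 => i; rewrite mxE; lra.
have h0 : h 0 = w 0 by rewrite /h cutoff0 expr1n mulr1.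
have cube0 : (0 : 'rV[R]_N) \in cube by rewrite inE => i; rewrite mxE; lra.
rewrite -h0; apply: le_trans (hmax _ cube0) _; rewrite le_max.
have [hx|hx] := leP (h x) 0; first by [].
rewrite /=; have /andP[g0 g1] := cutoff_bounds cx.
have {}g0 : 0 < cutoff x.
  rewrite lt_neqAle g0 andbT eq_sym; apply/eqP => gx.
  by move: hx; rewrite /h gx expr0n mulr0 ltxx.
have w0 : 0 < w x by move: hx; rewrite /h pmulr_lgt0 // exprn_gt0.
have inside i : -1 < x ord0 i < 1.
  have /andP[xm xp] := cx i; rewrite !lt_neqAle xm xp !andbT.
  by apply/andP; split; apply/eqP => xE; move: g0;
    rewrite (@cutoff_face _ _ i) ?ltxx //; [left|right].
have second i : w2 i x * cutoff x ^+ 2 <=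
    (4 * k.+2%:R * k.+3%:R + 2 * k.+2%:R) * w x.
  have [r r0 near_x] := cube_interior_ball cx (inside i).
  have [|E1 E2] := second_order_max (C1h i) (C2h i) r0 (x := x).
    by move=> s sr; apply: hmax; rewrite inE; exact: near_x.
  apply: (product_max_second w0 _ (cutoff1_bounds i cx) (cutoff2_bounds i cx) E1 E2).
  by rewrite g0.
have : c * w x `^ (1 + d) * cutoff x ^+ 2 <= M * c * w x.
  apply: le_trans (_ : \sum_i w2 i x * cutoff x ^+ 2 <= _).
    by rewrite -mulr_suml ler_pM2r ?exprn_gt0 //; exact: Dw.
  apply: le_trans (ler_sum _ (fun i _ => second i)) _.
  rewrite sumr_const card_ord -mulr_natl /M divfK ?gt_eqF //; lra.
rewrite powRDr // (powRr1 (ltW w0)) => H.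
have {}H : w x `^ d * cutoff x ^+ 2 <= M.
  rewrite -(ler_pM2l (mulr_gt0 c0 w0)); apply: le_trans (le_trans H _); lra.
have hd : h x `^ d <= M.
  apply: le_trans H; rewrite /h powRM ?(ltW w0) ?exprn_ge0 ?(ltW g0) // ler_pM2l ?powR_gt0 //.
  rewrite -!powR_mulrn ?(ltW g0) // -powRrM; apply: ger_powR => //.
  by rewrite g0.
have -> : h x = (h x `^ d) `^ d^-1.
  by rewrite -powRrM mulfV ?(gt_eqF d0) // powRr1 // ltW.
have M0 := lt_le_trans (powR_gt0 d hx) hd.
by apply: ge0_ler_powR; rewrite ?nnegrE ?powR_ge0 ?invr_ge0 // ltW.
Qed.

Definition half_exponent (theta : R) : R := (theta + 1) / 2.

Definition comparison_const (theta : R) : R := (Num.sqrt (half_exponent theta))^-1.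

Lemma half_exponent_gt1 (theta : R) : 1 < theta -> 1 < half_exponent theta.
Proof. by move=> theta1; rewrite /half_exponent; lra. Qed.

Lemma comparison_const_gt0 (theta : R) : 1 < theta -> 0 < comparison_const theta.
Proof.
by move=> /half_exponent_gt1 s1; rewrite invr_gt0 sqrtr_gt0; lra.
Qed.

Lemma comparison_const_sqr (theta : R) : 1 < theta ->
  comparison_const theta ^+ 2 * half_exponent theta = 1.
Proof.
move=> /half_exponent_gt1 s1.
by rewrite exprVn sqr_sqrtr ?mulVf ?gt_eqF //; lra.
Qed.

(** The choice a^2 s = 1 is what makes the zeroth order terms of the Laplacian of
    a u^s - v factor through a u^s - v itself. *)
Lemma comparison_at0 (theta : R) : 1 < theta ->
  exists B : R, forall u v : 'rV[R]_N -> R, positive_solution theta u v ->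
    comparison_const theta * u 0 `^ half_exponent theta - v 0 <= B.
Proof.
move=> theta1; have sE : half_exponent theta = (theta + 1) / 2 by [].
move: (comparison_const theta) (half_exponent theta) (half_exponent_gt1 theta1)
  (comparison_const_gt0 theta1) (comparison_const_sqr theta1) sE => a s s1 a0 aas sE.
have s0 : 0 < s by lra.
have s10 : 0 <= s - 1 by lra.
pose d := (s - 1) / s.
have d0 : 0 < d by rewrite divr_gt0 //; lra.
have c0 : 0 < a * s * a `^ (- d) by rewrite !mulr_gt0 ?powR_gt0.
have [B HB] := superlinear_bound c0 d0; exists B => u v [su sv uv0 Du Dv].
have u0 x : 0 < u x by case: (uv0 x).
pose w1 i x := a * (s * u x `^ (s - 1) * partial i u x) + -1 * partial i v x.
pose w2 i x := a * (s * u x `^ (s - 1) * partial i (partial i u) x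
  + partial i u x * (s * ((s - 1) * u x `^ (s - 1 - 1) * partial i u x)))
  + -1 * partial i (partial i v) x.
have C1 i : C1_along (evec R i) (fun x => a * u x `^ s - v x) (w1 i).
  apply: C1_along_ext (C1_alongD (C1_alongZ a (C1_along_powR s u0
    (smooth_C1_along i su))) (C1_alongZ (-1) (smooth_C1_along i sv))) _ _ => // x.
  by rewrite mulN1r.
have C2 i : C1_along (evec R i) (w1 i) (w2 i).
  apply: C1_along_ext (C1_alongD (C1_alongZ a (C1_alongM (C1_alongZ s
    (C1_along_powR (s - 1) u0 (smooth_C1_along i su)))
    (smooth_C1_along i (smooth_partial i su))))
    (C1_alongZ (-1) (smooth_C1_along i (smooth_partial i sv)))) _ _ => // x.
apply: HB C1 C2 _ _.
  have cu : continuous (fun x => u x `^ s).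
    move=> x; apply: (@continuous_comp _ _ _ u (fun y : R => y `^ s)).
      by have := su 0%N; apply.
    exact: continuous_at_powR.
  move=> x; have := sv 0%N => /(_ x) cv.
  exact: (cvgB (cvgM (cvg_cst a) (cu x)) cv).
move=> x wx.
have us : u x `^ s = u x `^ (s - 1) * u x.
  by rewrite -[X in _ * X]powRr1 ?ltW // -powRDr // subrK.
have sumE : a * s * u x `^ (s - 1) * (a * u x `^ s - v x) <= \sum_i w2 i x.
  have Lu : laplacian u x = - v x by rewrite -Du opprK.
  have Lv : laplacian v x = - (u x `^ (s - 1) * u x `^ s).
    by rewrite -powRDr // (_ : s - 1 + s = theta) ?sE -?Dv ?opprK //; lra.
  have -> : a * s * u x `^ (s - 1) * (a * u x `^ s - v x) =
      a * s * u x `^ (s - 1) * laplacian u x - laplacian v x.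
    rewrite Lu Lv opprK -[_ * u x `^ s in RHS]mul1r -aas.
    by move: (u x `^ (s - 1)) (u x `^ s) => *; ring.
  rewrite /laplacian mulr_sumr -sumrB.
  apply: ler_sum => i _; rewrite /w2 -subr_ge0.
  rewrite [leRHS](_ : _ = a * s * (s - 1) * u x `^ (s - 1 - 1) * partial i u x ^+ 2); last first.
    move: (partial i u x) (partial i (partial i u) x) (partial i (partial i v) x).
    by move: (u x `^ (s - 1)) (u x `^ (s - 1 - 1)) => *; ring.
  rewrite mulr_ge0 ?sqr_ge0 // mulr_ge0 ?powR_ge0 //.
  exact: mulr_ge0 (mulr_ge0 (ltW a0) (ltW s0)) s10.
apply: le_trans sumE; rewrite [1 + d]addrC (powRDr d 1 wx) (powRr1 (ltW wx)) mulrA ler_pM2r //.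
rewrite -!mulrA ler_pM2l // ler_pM2l // powRN mulrC ler_pdivrMr ?powR_gt0 //.
have -> : u x `^ (s - 1) = (u x `^ s) `^ d.
  by rewrite -powRrM /d mulrC divfK // gt_eqF.
rewrite [_ * a `^ d]mulrC -powRM ?powR_ge0 ?(ltW a0) //.
apply: ge0_ler_powR; rewrite ?nnegrE ?(ltW d0) ?(ltW wx) ?mulr_ge0 ?powR_ge0 ?(ltW a0) //.
by rewrite gerBl; case: (uv0 x) => _ /ltW.
Qed.

(** The bound at the origin applies to every rescaling of the solution, while
    a u^s - v is multiplied by an arbitrarily large factor. *)
Lemma comparison (theta : R) (u v : 'rV[R]_N -> R) x : 1 < theta ->
  positive_solution theta u v ->
  comparison_const theta * u x `^ half_exponent theta <= v x.
Proof.
move=> theta1 uv; have [B HB] := comparison_at0 theta1; rewrite -subr_le0 leNgt; apply/negP => w0.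
set w := _ - _ in w0.
have al2 : 0 < scaling_exponent theta + 2 by rewrite addr_gt0 // divr_gt0 //; lra.
pose L := ((`|B| + 1) / w) `^ (scaling_exponent theta + 2)^-1.
have B1 : 0 < (`|B| + 1) / w by rewrite divr_gt0 // ltr_wpDl.
have L0 : 0 < L by rewrite powR_gt0.
have LE : L `^ (scaling_exponent theta + 2) = (`|B| + 1) / w.
  by rewrite -powRrM mulVf ?(gt_eqF al2) // powRr1 // ltW.
have := HB _ _ (positive_solution_zoom theta1 x L0 uv).
rewrite /zoom scaler0 addr0 powRM ?powR_ge0 //; last by rewrite ltW //; case: uv => _ _ /(_ x) [].
rewrite -powRrM (_ : scaling_exponent theta * half_exponent theta = scaling_exponent theta + 2); last first.
  rewrite /scaling_exponent /half_exponent; field; rewrite subr_eq0 gt_eqF //.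
rewrite mulrCA -mulrBr -/w LE divfK ?gt_eqF // => H.
by have := ler_norm B; lra.
Qed.

End Comparison.

(** * Numerical inequalities for the energy estimate *)

Section Numeric.
Context {R : realType}.

Lemma young (e x y : R) : 0 < e -> 2 * x * y <= e * x ^+ 2 + y ^+ 2 / e.
Proof.
move=> e0; rewrite -subr_ge0.
have -> : e * x ^+ 2 + y ^+ 2 / e - 2 * x * y = (e * x - y) ^+ 2 / e.
  by field; rewrite gt_eqF.
by rewrite divr_ge0 ?sqr_ge0 ?ltW.
Qed.

Lemma abs_prod_le (x y c : R) : `|y| <= c -> x * y <= c * `|x|.
Proof.
move=> yc; apply: le_trans (ler_norm _) _; rewrite normrM mulrC.
by rewrite ler_wpM2r.
Qed.

(** Here y stands for g^3 d_i v / v.  The constant in front of g^4 does not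
    involve A: this is what later allows A to be chosen so that - A g^4 absorbs
    this term. *)
Lemma reduced_coordinate_bound (q lam A rho g g1 y M n k B : R) :
  0 <= A -> 0 <= rho -> 0 <= g <= 1 -> `|g1| <= 2 -> 1 <= q -> 0 <= n ->
  k = lam * (q - 1) - q ^+ 2 / 4 -> 0 < k -> B = `|q * M / 2 - lam * M| ->
  4^-1 * (q * y + M * g1 * g ^+ 2) ^+ 2 - lam * ((q - 1) * y ^+ 2 + M * g1 * g ^+ 2 * y)
    + A * rho * (- (2 * (q - 1) * n * y * g1) + 2 * n * g ^+ 3) <=
  (M ^+ 2 + 2 * B ^+ 2 / k + 1) * g ^+ 4 +
  (8 * ((q - 1) * n * A) ^+ 2 / k + (n * A) ^+ 2) * rho ^+ 2.
Proof.
move=> A0 r0 /andP[g0 gle1] g1le q1 n0 kE k0 BE.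
have g1s : g1 ^+ 2 <= 4 by move: g1le; rewrite ler_norml => /andP[? ?]; nra.
have T0 : 4^-1 * (q * y + M * g1 * g ^+ 2) ^+ 2
    - lam * ((q - 1) * y ^+ 2 + M * g1 * g ^+ 2 * y) =
    - k * y ^+ 2 + (q * M / 2 - lam * M) * y * g1 * g ^+ 2
     + 4^-1 * M ^+ 2 * g ^+ 4 * g1 ^+ 2.
  by rewrite kE; field.
have T1 : (q * M / 2 - lam * M) * y * g1 * g ^+ 2 <= 2 * (B * g ^+ 2) * `|y|.
  have := abs_prod_le ((q * M / 2 - lam * M) * y) g1le.
  rewrite normrM -BE => H.
  apply: le_trans (ler_wpM2r (exprn_ge0 2 g0) H) _; rewrite le_eqVlt; apply/orP; left.
  by apply/eqP; ring.
have T2 : 4^-1 * M ^+ 2 * g ^+ 4 * g1 ^+ 2 <= M ^+ 2 * g ^+ 4.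
  have P : 0 <= 4^-1 * M ^+ 2 * g ^+ 4.
    by apply: mulr_ge0 (exprn_ge0 4 g0); rewrite mulr_ge0 ?sqr_ge0.
  apply: le_trans (ler_wpM2l P g1s) _; rewrite le_eqVlt; apply/orP; left.
  by apply/eqP; field.
have nq0 : 0 <= (q - 1) * n * (A * rho).
  by apply: mulr_ge0; apply: mulr_ge0 => //; rewrite subr_ge0.
have T3 : A * rho * - (2 * (q - 1) * n * y * g1) <=
    2 * (2 * ((q - 1) * n * A) * rho) * `|y|.
  have := @abs_prod_le (- y) g1 2 g1le; rewrite normrN => /(ler_wpM2l nq0) H.
  have -> : A * rho * - (2 * (q - 1) * n * y * g1) =
     2 * ((q - 1) * n * (A * rho) * (- y * g1)) by ring.
  apply: le_trans (ler_wpM2l _ H) _ => //; rewrite le_eqVlt; apply/orP; left.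
  by apply/eqP; ring.
have T4 : A * rho * (2 * n * g ^+ 3) <= g ^+ 4 + (n * A) ^+ 2 * rho ^+ 2.
  have P : 0 <= 2 * (n * A * rho) * g ^+ 2.
    by apply: mulr_ge0 (exprn_ge0 2 g0); rewrite !mulr_ge0.
  have := ler_wpM2l P gle1; have := @young 1 (g ^+ 2) (n * A * rho) ltr01.
  have -> : A * rho * (2 * n * g ^+ 3) = 2 * (n * A * rho) * g ^+ 2 * g by ring.
  have -> : g ^+ 4 + (n * A) ^+ 2 * rho ^+ 2 =
     1 * (g ^+ 2) ^+ 2 + (n * A * rho) ^+ 2 / 1 by field.
  have -> : 2 * (n * A * rho) * g ^+ 2 = 2 * g ^+ 2 * (n * A * rho) by ring.
  by rewrite mulr1 => h1 h2; apply: le_trans h2 h1.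
have k20 : 0 < k / 2 by rewrite divr_gt0.
have Y1 : 2 * (B * g ^+ 2) * `|y| <= 2 * B ^+ 2 / k * g ^+ 4 + k / 2 * y ^+ 2.
  have := @young (k / 2) `|y| (B * g ^+ 2) k20; rewrite real_normK ?num_real //.
  have -> : (B * g ^+ 2) ^+ 2 / (k / 2) = 2 * B ^+ 2 / k * g ^+ 4.
    by field; rewrite gt_eqF.
  by rewrite (mulrAC 2 `|y|) (addrC (k / 2 * _)).
have Y2 : 2 * (2 * ((q - 1) * n * A) * rho) * `|y| <=
    8 * ((q - 1) * n * A) ^+ 2 / k * rho ^+ 2 + k / 2 * y ^+ 2.
  have := @young (k / 2) `|y| (2 * ((q - 1) * n * A) * rho) k20.
  rewrite real_normK ?num_real //.
  have -> : (2 * ((q - 1) * n * A) * rho) ^+ 2 / (k / 2) =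
      8 * ((q - 1) * n * A) ^+ 2 / k * rho ^+ 2.
    by field; rewrite gt_eqF.
  by rewrite (mulrAC 2 `|y|) (addrC (k / 2 * _)).
rewrite T0 [A * rho * (_ + _)]mulrDr.
by clear -T1 T2 T3 T4 Y1 Y2; lra.
Qed.

(** The contribution of one coordinate to the divergence, divided by v^q.  The
    variables z and c are the logarithmic derivatives of zeta and chi, r that of
    v; z2, c2, vv, uu are the second derivatives divided by zeta, chi, v, v; and
    G g^6 is the power of the cutoff.  The squares z^2 and c^2 complete the
    square with the cross terms, and the terms in r are those of
    [reduced_coordinate_bound]. *)
Lemma coordinate_bound (q lam A rho g g1 g2 r vv uu z z2 c c2 M n k B G : R) :
  0 <= A -> 0 <= rho -> 0 <= g <= 1 -> `|g1| <= 2 -> -2 <= g2 <= 0 -> 2 <= q ->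
  1 <= n -> k = lam * (q - 1) - q ^+ 2 / 4 -> 0 < k ->
  B = `|q * M / 2 - lam * M| -> 0 <= G ->
  2^-1 * ((z2 - z ^+ 2) + (c2 - c ^+ 2)) * (G * g ^+ 6)
    + 2^-1 * (z + c) * (G * g ^+ 5 * (q * r * g + M * g1))
  - lam * (r * (G * g ^+ 5 * (q * r * g + M * g1)) + (vv - r ^+ 2) * (G * g ^+ 6))
  - A * (rho * (G * g ^+ 2 * ((q - 1) * r * g + (n - 1) * g1) * ((q - 1) * r * g + n * g1)
            + G * g ^+ 3 * ((q - 1) * (vv - r ^+ 2) * g + (q - 1) * r * g1 + n * g2))
         - uu * (G * g ^+ 4))
  <= G * (2^-1 * (z2 + c2) * g ^+ 6 - lam * vv * g ^+ 6 + A * uu * g ^+ 4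
          - A * rho * (q - 1) * vv * g ^+ 4
       + ((M ^+ 2 + 2 * B ^+ 2 / k + 1) * g ^+ 4 +
          (8 * ((q - 1) * n * A) ^+ 2 / k + (n * A) ^+ 2) * rho ^+ 2)).
Proof.
move=> A0 r0 g01 g1le /andP[g2m g2p] q2 n1 kE k0 BE G0.
have q1 : 1 <= q by lra.
have n0 : 0 <= n by lra.
have Hred := reduced_coordinate_bound (r * g ^+ 3) A0 r0 g01 g1le q1 n0 kE k0 BE.
have /andP[g0 _] := g01.
pose Y := q * (r * g ^+ 3) + M * g1 * g ^+ 2.
(* The difference of the two sides is G times the sum of the slack in the
   reduced bound and the quantities S1, ..., S5; S3 is nonnegative as
   q >= 2. *)
have S1 : 0 <= (2 * z * g ^+ 3 - Y) ^+ 2 / 8 by rewrite divr_ge0 ?sqr_ge0.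
have S2 : 0 <= (2 * c * g ^+ 3 - Y) ^+ 2 / 8 by rewrite divr_ge0 ?sqr_ge0.
have Ar : 0 <= A * rho by rewrite mulr_ge0.
have S3 : 0 <= A * rho * ((q - 1) * (q - 2) * (r ^+ 2 * g ^+ 4)).
  apply: (mulr_ge0 Ar); apply: mulr_ge0; first by apply: mulr_ge0; lra.
  by rewrite mulr_ge0 ?sqr_ge0 ?exprn_ge0.
have S4 : 0 <= A * rho * (n * (n - 1) * (g ^+ 2 * g1 ^+ 2)).
  apply: (mulr_ge0 Ar); apply: mulr_ge0; first by apply: mulr_ge0; lra.
  by rewrite mulr_ge0 ?sqr_ge0 ?exprn_ge0.
have S5 : 0 <= A * rho * (n * g ^+ 3 * (g2 + 2)).
  apply: (mulr_ge0 Ar); apply: mulr_ge0; last by lra.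
  by rewrite mulr_ge0 ?exprn_ge0.
move: Hred; set C := _ * g ^+ 4 + _ * rho ^+ 2; rewrite -subr_ge0 => Hred.
rewrite -subr_ge0.
have := mulr_ge0 G0 (addr_ge0 (addr_ge0 (addr_ge0 (addr_ge0 (addr_ge0 Hred S1) S2) S3) S4) S5).
move/le_trans; apply; rewrite le_eqVlt; apply/orP; left; apply/eqP.
by rewrite /Y; field.
Qed.

(** A bound for v^sigma g^2 gives one for v^q times any sufficiently large power
    of g; the factor rho^2 costs v^(-2 sigma), which the factor v^q compensates
    where v is small because q >= 2 sigma. *)
Lemma weight_bounds (q sigma D v g rho C : R) (m : nat) :
  0 < v -> 0 <= g <= 1 -> 0 < sigma -> 0 <= C -> 2 * sigma <= q ->
  (0 < m)%N -> 2 * q <= m%:R * sigma -> 0 <= rho -> 0 <= D ->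
  rho <= C * v `^ (- sigma) -> v `^ sigma * g ^+ 2 <= D ->
  v `^ q * g ^+ m <= D `^ (q / sigma) /\
  v `^ q * g ^+ m * rho ^+ 2 <= C ^+ 2 * (1 + D `^ (q / sigma)).
Proof.
move=> v0 /andP[g0 g1] s0 C0 qs m0 ms r0 D0 rC vD.
have q0 : 0 <= q by lra.
have W : v `^ q * g ^+ m <= D `^ (q / sigma).
  have [->|gN0] := eqVneq g 0.
    by rewrite expr0n gtn_eqF // mulr0 powR_ge0.
  have gp : 0 < g by rewrite lt_neqAle eq_sym gN0.
  apply: le_trans (_ : (v `^ sigma * g ^+ 2) `^ (q / sigma) <= _); last first.
    by apply: ge0_ler_powR; rewrite ?nnegrE ?divr_ge0 ?mulr_ge0 ?powR_ge0 ?(ltW s0).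
  rewrite powRM ?powR_ge0 ?exprn_ge0 // -powRrM [sigma * _]mulrC divfK ?(gt_eqF s0) //.
  rewrite ler_wpM2l ?powR_ge0 // -!powR_mulrn // -powRrM.
  by apply: ger_powR; rewrite ?gp // mulrA ler_pdivrMr.
split=> //; have gm0 : 0 <= g ^+ m by rewrite exprn_ge0.
have gm1 : g ^+ m <= 1 by rewrite exprn_ile1.
have rC2 : rho ^+ 2 <= C ^+ 2 * v `^ (- (2 * sigma)).
  rewrite (_ : C ^+ 2 * _ = (C * v `^ (- sigma)) ^+ 2).
    by rewrite ler_sqr ?nnegrE ?mulr_ge0 ?powR_ge0.
  rewrite exprMn -[v `^ _ ^+ 2]powR_mulrn ?powR_ge0 // -powRrM mulNr.
  by rewrite [sigma * _]mulrC.
apply: le_trans (ler_wpM2l (mulr_ge0 (powR_ge0 v q) gm0) rC2) _.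
rewrite mulrCA ler_wpM2l ?sqr_ge0 // mulrAC -powRDr //.
have [v1|v1] := leP v 1.
  apply: le_trans (_ : 1 <= _); last by rewrite lerDl powR_ge0.
  apply: mulr_ile1; rewrite ?powR_ge0 // -[leRHS](powRr0 v).
  by apply: ger_powR; rewrite ?v0 //; lra.
apply: le_trans (_ : D `^ (q / sigma) <= _); last by rewrite lerDr.
apply: le_trans W; rewrite ler_wpM2r //; apply: ler_powR; first exact: ltW.
by lra.
Qed.

(** With p = u^(s-1) and rho = u/v: for rho <= eps g^2 the two error terms are
    absorbed by the negative ones, otherwise Q G and Q G rho^2 are bounded and
    the errors are constants, since rho p = u^s/v is bounded by the comparison. *)
Lemma absorption (k2 E1 E2 eps K1 K2 a p rho Q G g : R) :
  0 < k2 -> 0 <= E1 -> 0 <= E2 -> 0 < a -> 0 <= eps -> 0 <= p -> 0 <= rho -> 0 <= Q * G ->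
  0 <= g <= 1 ->
  E1 * eps <= k2 / 2 -> E2 * eps ^+ 2 <= 1 -> rho * p <= a^-1 -> 0 <= K1 -> 0 <= K2 ->
  (eps * g ^+ 2 < rho -> Q * G <= K1 /\ Q * G * rho ^+ 2 <= K2) ->
  Q * G * (- k2 * p * g ^+ 6 - g ^+ 4 + E1 * (rho * p) * g ^+ 4 + E2 * rho ^+ 2) <=
  (E1 / a * K1 + E2 * K2) - k2 / 2 * (p * (Q * (G * g ^+ 6))).
Proof.
move=> k20 E10 E20 a0 e0 p0 r0 QG0 /andP[g0 g1] Ee Ee2 rp K10 K20 large.
have E1a : 0 <= E1 / a by rewrite divr_ge0 // ltW.
have K0 : 0 <= E1 / a * K1 + E2 * K2 by rewrite addr_ge0 // mulr_ge0.
have g40 : 0 <= g ^+ 4 by rewrite exprn_ge0.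
have g60 : 0 <= g ^+ 6 by rewrite exprn_ge0.
have -> : p * (Q * (G * g ^+ 6)) = Q * G * (p * g ^+ 6) by ring.
have pg : 0 <= p * g ^+ 6 by rewrite mulr_ge0.
have [sm|] := leP rho (eps * g ^+ 2).
  have T1 : E1 * (rho * p) * g ^+ 4 <= k2 / 2 * (p * g ^+ 6).
    apply: le_trans (_ : E1 * eps * (p * g ^+ 6) <= _); last exact: ler_wpM2r.
    have -> : E1 * eps * (p * g ^+ 6) = E1 * p * g ^+ 4 * (eps * g ^+ 2) by ring.
    have -> : E1 * (rho * p) * g ^+ 4 = E1 * p * g ^+ 4 * rho by ring.
    by apply: ler_wpM2l sm; rewrite !mulr_ge0.
  have T2 : E2 * rho ^+ 2 <= g ^+ 4.
    apply: le_trans (_ : E2 * (eps * g ^+ 2) ^+ 2 <= _).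
      by apply: (ler_wpM2l E20); rewrite ler_sqr ?nnegrE // mulr_ge0 ?exprn_ge0.
    have -> : E2 * (eps * g ^+ 2) ^+ 2 = E2 * eps ^+ 2 * g ^+ 4 by ring.
    by rewrite -[leRHS]mul1r ler_wpM2r.
  apply: le_trans (_ : Q * G * (- (k2 / 2) * (p * g ^+ 6)) <= _).
    apply: (ler_wpM2l QG0); have -> : - k2 * p * g ^+ 6 = - k2 * (p * g ^+ 6) by ring.
    by clear -T1 T2; lra.
  have -> : Q * G * (- (k2 / 2) * (p * g ^+ 6)) = - (k2 / 2 * (Q * G * (p * g ^+ 6))) by ring.
  by rewrite lerDr.
move=> /large[QK1 QK2].
have T1 : E1 * (rho * p) * g ^+ 4 <= E1 / a.
  rewrite -[leRHS]mulr1; apply: ler_pM => //; first by rewrite !mulr_ge0.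
    exact: ler_wpM2l.
  exact: exprn_ile1.
have T2 := ler_wpM2l QG0 T1.
have T3 := ler_wpM2l E1a QK1.
have T4 := ler_wpM2l E20 QK2.
have k2' : 0 <= k2 / 2 by rewrite divr_ge0 // ltW.
have T5 : 0 <= Q * G * (k2 / 2 * (p * g ^+ 6) + g ^+ 4).
  by apply: (mulr_ge0 QG0); apply: addr_ge0 => //; exact: mulr_ge0.
have -> : Q * G * (- k2 * p * g ^+ 6 - g ^+ 4 + E1 * (rho * p) * g ^+ 4 + E2 * rho ^+ 2)
  = Q * G * (E1 * (rho * p) * g ^+ 4) + E2 * (Q * G * rho ^+ 2)
    - Q * G * (k2 / 2 * (p * g ^+ 6) + g ^+ 4) - k2 / 2 * (Q * G * (p * g ^+ 6)) by field.
by clear -T2 T3 T4 T5; lra.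
Qed.

End Numeric.

Section Weights.
Context {R : realType} {V : normedModType R}.
Implicit Types (f g v : V -> R).

Lemma C1_along_logder (e : V) f f1 f2 : (forall x, 0 < f x) ->
  C1_along e f f1 -> C1_along e f1 f2 ->
  C1_along e (fun x => f1 x / f x) (fun x => f2 x / f x - (f1 x / f x) ^+ 2).
Proof.
move=> f0 C1 C2.
apply: C1_along_ext (C1_alongM C2 (C1_alongV f0 C1)) _ _ => // x.
by field; rewrite gt_eqF.
Qed.

Lemma C1_along_weight (e : V) (b : R) (n : nat) v v1 g g1 : (forall x, 0 < v x) ->
  C1_along e v v1 -> C1_along e g g1 ->
  C1_along e (fun x => v x `^ b * g x ^+ n.+1)
    (fun x => v x `^ b * g x ^+ n * (b * (v1 x / v x) * g x + n.+1%:R * g1 x)).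
Proof.
move=> v0 Cv Cg.
apply: C1_along_ext (C1_alongM (C1_along_powR b v0 Cv) (C1_alongX n.+1 Cg)) _ _ => // x.
rewrite /= powRDr // powRN powRr1 ?(ltW (v0 x)) // exprS.
by move: (n.+1%:R : R) => N; field; rewrite gt_eqF.
Qed.

Lemma C1_along_weight2 (e : V) (b : R) (n : nat) v v1 v2 g g1 g2 :
  (forall x, 0 < v x) ->
  C1_along e v v1 -> C1_along e v1 v2 -> C1_along e g g1 -> C1_along e g1 g2 ->
  C1_along e
    (fun x => v x `^ b * g x ^+ n.+1 * (b * (v1 x / v x) * g x + n.+2%:R * g1 x))
    (fun x => v x `^ b *
      (g x ^+ n * (b * (v1 x / v x) * g x + n.+1%:R * g1 x)
         * (b * (v1 x / v x) * g x + n.+2%:R * g1 x)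
       + g x ^+ n.+1 * (b * (v2 x / v x - (v1 x / v x) ^+ 2) * g x
            + b * (v1 x / v x) * g1 x + n.+2%:R * g2 x))).
Proof.
move=> v0 Cv Cv1 Cg Cg1.
apply: C1_along_ext (C1_alongM (C1_along_weight b n v0 Cv Cg)
  (C1_alongD (C1_alongM (C1_alongZ b (C1_along_logder v0 Cv Cv1)) Cg)
    (C1_alongZ n.+2%:R Cg1))) _ _ => // x /=.
rewrite exprS; move: (n.+1%:R : R) (n.+2%:R : R) => N1 N2.
by move: (v1 x / v x) (v2 x / v x) (v x `^ b) (g x ^+ n) => *; ring.
Qed.

End Weights.

(** * The energy field *)

Section Field.
Context {R : realType} {V : normedModType R}.

(** One component of the combined field and its derivative, written in the form
    that [coordinate_bound] estimates. *)
Lemma C1_along_field (e : V) (z z1 z2 c c1 c2 u u1 u2 v v1 v2 g g1 g2 : V -> R)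
    (q lam A : R) (m : nat) :
  (forall x, 0 < z x) -> (forall x, 0 < c x) -> (forall x, 0 < v x) ->
  C1_along e z z1 -> C1_along e z1 z2 -> C1_along e c c1 -> C1_along e c1 c2 ->
  C1_along e u u1 -> C1_along e u1 u2 -> C1_along e v v1 -> C1_along e v1 v2 ->
  C1_along e g g1 -> C1_along e g1 g2 ->
  C1_along e
   (fun x => 2^-1 * (z1 x / z x + c1 x / c x) * (v x `^ q * g x ^+ m.+4.+2)
     - lam * (v1 x / v x * (v x `^ q * g x ^+ m.+4.+2))
     - A * (u x * (v x `^ (q - 1) * g x ^+ m.+3
              * ((q - 1) * (v1 x / v x) * g x + m.+4%:R * g1 x))
            - u1 x * (v x `^ (q - 1) * g x ^+ m.+4)))
   (fun x => v x `^ q *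
    (2^-1 * ((z2 x / z x - (z1 x / z x) ^+ 2) + (c2 x / c x - (c1 x / c x) ^+ 2))
       * (g x ^+ m * g x ^+ 6)
    + 2^-1 * (z1 x / z x + c1 x / c x)
       * (g x ^+ m * g x ^+ 5 * (q * (v1 x / v x) * g x + m.+4.+2%:R * g1 x))
  - lam * (v1 x / v x
       * (g x ^+ m * g x ^+ 5 * (q * (v1 x / v x) * g x + m.+4.+2%:R * g1 x))
      + (v2 x / v x - (v1 x / v x) ^+ 2) * (g x ^+ m * g x ^+ 6))
  - A * (u x / v x * (g x ^+ m * g x ^+ 2
             * ((q - 1) * (v1 x / v x) * g x + (m.+4%:R - 1) * g1 x)
             * ((q - 1) * (v1 x / v x) * g x + m.+4%:R * g1 x)
            + g x ^+ m * g x ^+ 3 * ((q - 1) * (v2 x / v x - (v1 x / v x) ^+ 2) * g x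
               + (q - 1) * (v1 x / v x) * g1 x + m.+4%:R * g2 x))
         - u2 x / v x * (g x ^+ m * g x ^+ 4)))).
Proof.
move=> z0 c0 v0 Cz Cz1 Cc Cc1 Cu Cu1 Cv Cv1 Cg Cg1.
have Lz := C1_along_logder z0 Cz Cz1.
have Lc := C1_along_logder c0 Cc Cc1.
have Lv := C1_along_logder v0 Cv Cv1.
have W := C1_along_weight q m.+4.+1 v0 Cv Cg.
have U := C1_along_weight (q - 1) m.+3 v0 Cv Cg.
have U1 := C1_along_weight2 (q - 1) m.+2 v0 Cv Cv1 Cg Cg1.
apply: C1_along_ext (C1_alongD (C1_alongD
   (C1_alongM (C1_alongZ 2^-1 (C1_alongD Lz Lc)) W)
   (C1_alongZ (- lam) (C1_alongM Lv W)))
   (C1_alongZ (- A) (C1_alongD (C1_alongM Cu U1) (C1_alongZ (-1) (C1_alongM Cu1 U)))))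
  _ _ => x /=.
  by rewrite !mulNr mul1r.
have -> : v x `^ (q - 1) = v x `^ q / v x.
  by rewrite powRDr // powRN powRr1 ?(ltW (v0 x)).
have -> : m.+3%:R = m.+4%:R - 1 :> R by rewrite -[m.+4%:R]natr1 addrK.
rewrite !exprS expr0; move: (m.+4%:R : R) (m.+4.+2%:R : R) (v x `^ q) (g x ^+ m) => N1 N2 Q G.
move: (z1 x / z x) (z2 x / z x) (c1 x / c x) (c2 x / c x) => ? ? ? ?.
move: (v0 x); move: (v x) (v1 x) (v2 x) (g x) (g1 x) (g2 x) (u x) (u1 x) (u2 x) => y *.
by field; rewrite gt_eqF.
Qed.

End Field.

Section Energy.
Context {R : realType} {N : nat}.
Implicit Types (x : 'rV[R]_N) (i : 'I_N).

Lemma small_eps (k E1 E2 : R) : 0 < k -> 0 <= E1 -> 0 <= E2 ->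
  exists2 eps : R, 0 < eps & E1 * eps <= k /\ E2 * eps ^+ 2 <= 1.
Proof.
move=> k0 E10 E20.
pose eps := Num.min 1 (Num.min (k / (E1 + 1)) (E2 + 1)^-1).
have E11 : 0 < E1 + 1 by lra.
have E21 : 0 < E2 + 1 by lra.
have eps0 : 0 < eps by rewrite !lt_min ltr01 divr_gt0 // invr_gt0.
have e1 : eps <= 1 by rewrite ge_min lexx.
have e2 : (E1 + 1) * eps <= k.
  by rewrite mulrC -ler_pdivlMr // !ge_min lexx orbT.
have e3 : eps * (E2 + 1) <= 1.
  by rewrite -ler_pdivlMr // div1r !ge_min lexx !orbT.
exists eps => //; split; first by lra.
apply: le_trans e3; have : eps ^+ 2 <= eps by rewrite expr2 ger_pMr.
move=> /(ler_wpM2l E20); lra.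
Qed.

(** Both are restatements of a u^s <= v: u^s/v <= 1/a, and u <= (v/a)^(1/s). *)
Lemma ratio_bounds (theta a u v : R) : 1 < theta -> 0 < a -> 0 < u -> 0 < v ->
  a * u `^ half_exponent theta <= v ->
  u / v * u `^ (half_exponent theta - 1) <= a^-1 /\
  u / v <= a `^ (- (half_exponent theta)^-1)
           * v `^ (- ((half_exponent theta - 1) / half_exponent theta)).
Proof.
move=> theta1; have := half_exponent_gt1 theta1.
move: (half_exponent theta) => s s1 a0 u0 v0 auv; split.
  rewrite mulrAC ler_pdivrMr // ler_pdivlMl //.
  by rewrite -{1}[u](powRr1 (ltW u0)) -powRDr // addrC subrK.
have s0 : 0 < s by lra.
have sN0 : s != 0 by rewrite gt_eqF.
have uav : u <= (v / a) `^ s^-1.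
  rewrite -{1}[u](powRr1 (ltW u0)) -(mulfV sN0) powRrM.
  by apply: ge0_ler_powR; rewrite ?nnegrE ?powR_ge0 ?invr_ge0 ?divr_ge0 ?(ltW s0)
    ?(ltW v0) ?(ltW a0) // ler_pdivlMr // mulrC.
rewrite ler_pdivrMr // -mulrA -{2}[v](powRr1 (ltW v0)) -powRDr //.
have -> : - ((s - 1) / s) + 1 = s^-1 by field; rewrite gt_eqF.
move: uav; rewrite powRM ?invr_ge0 ?(ltW v0) ?(ltW a0) //.
by rewrite -[a^-1](powR_inv1 (ltW a0)) -powRrM mulN1r mulrC.
Qed.

(** What the equations contribute: zz, cc, uu, vv are the Laplacians of zeta, chi,
    u, v divided by zeta, chi, v, v, and wz = chi/zeta.  Stability enters as the
    arithmetic-geometric mean inequality wz + th^2 p^2 / wz >= 2 th p with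
    th = sqrt theta. *)
Lemma divergence_reduction (a th lam b A C1 C2 NN p rho zz cc uu vv wz g : R) :
  0 < a -> 0 <= lam -> 0 <= A -> 0 <= b -> 0 <= p -> 0 <= rho -> 0 <= g -> 0 <= th ->
  rho * p <= a^-1 ->
  A = NN * C1 + 1 -> zz = - wz -> 0 < wz -> cc = - (th ^+ 2 * p ^+ 2 / wz) ->
  uu = - 1 -> vv = - (p * (rho * p)) ->
  2^-1 * (zz + cc) * g ^+ 6 - lam * vv * g ^+ 6 + A * uu * g ^+ 4
     - A * rho * b * vv * g ^+ 4 + NN * (C1 * g ^+ 4 + C2 * rho ^+ 2) <=
  - (th - lam / a) * p * g ^+ 6 - g ^+ 4 + A * b / a * (rho * p) * g ^+ 4
    + NN * C2 * rho ^+ 2.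
Proof.
move=> a0 lam0 A0 b0 p0 r0 g0 th0 rp AE -> wz0 -> -> ->.
have rp0 : 0 <= rho * p by rewrite mulr_ge0.
have g60 : 0 <= g ^+ 6 by rewrite exprn_ge0.
have g40 : 0 <= g ^+ 4 by rewrite exprn_ge0.
have T1 : 2^-1 * (- wz + - (th ^+ 2 * p ^+ 2 / wz)) * g ^+ 6 <= - th * p * g ^+ 6.
  rewrite ler_wpM2r // -subr_ge0.
  have -> : - th * p - 2^-1 * (- wz - th ^+ 2 * p ^+ 2 / wz) = (wz - th * p) ^+ 2 / (2 * wz).
    by field; rewrite gt_eqF.
  by rewrite divr_ge0 ?sqr_ge0 // mulr_ge0 // ltW.
have T2 : lam * (p * (rho * p)) * g ^+ 6 <= lam / a * p * g ^+ 6.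
  rewrite ler_wpM2r // -mulrA (ler_wpM2l lam0) // mulrC.
  exact: ler_wpM2r.
have T3 : A * rho * b * (p * (rho * p)) * g ^+ 4 <= A * b / a * (rho * p) * g ^+ 4.
  rewrite ler_wpM2r //.
  have -> : A * rho * b * (p * (rho * p)) = A * b * (rho * p) * (rho * p) by ring.
  by rewrite ler_wpM2r // ler_wpM2l // mulr_ge0.
have T4 : A * g ^+ 4 = NN * C1 * g ^+ 4 + g ^+ 4 by rewrite AE; ring.
by clear -T1 T2 T3 T4; lra.
Qed.

Lemma sum_coordinates (h lam A r b T G6 G4 z c v : R) (z2 c2 u2 v2 : 'I_N -> R) :
  \sum_i (h * (z2 i / z + c2 i / c) * G6 - lam * (v2 i / v) * G6 + A * (u2 i / v) * G4
           - A * r * b * (v2 i / v) * G4 + T) =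
  h * ((\sum_i z2 i) / z + (\sum_i c2 i) / c) * G6 - lam * ((\sum_i v2 i) / v) * G6
  + A * ((\sum_i u2 i) / v) * G4 - A * r * b * ((\sum_i v2 i) / v) * G4 + N%:R * T.
Proof.
rewrite big_split /= sumr_const card_ord -[T *+ N]mulr_natl; congr (_ + _).
rewrite sumrB big_split sumrB /= -!mulr_suml -!mulr_sumr -!mulr_suml.
by rewrite big_split /= -!mulr_suml.
Qed.

(** The constants are chosen before the solution; this uniformity is what the
    final rescaling exploits. *)
Lemma energy_field (theta q lam : R) : 1 < theta -> 2 <= q ->
  q ^+ 2 / 4 < lam * (q - 1) -> lam < comparison_const theta * Num.sqrt theta ->
  exists (m : nat) (kap K : R), 0 < kap /\
  forall u v : 'rV[R]_N -> R,
    positive_solution theta u v -> stable theta u v ->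
  exists F F' : 'I_N -> 'rV[R]_N -> R,
    [/\ forall i, C1_along (evec R i) (F i) (F' i),
        forall i x, x ord0 i = -1 \/ x ord0 i = 1 -> F i x = 0
      & forall x, cube x -> \sum_i F' i x <=
          K - kap * (u x `^ (half_exponent theta - 1)
                     * (v x `^ q * cutoff x ^+ m))].
Proof.
move=> theta1 q2 qlam lama.
pose s := half_exponent theta; have s1 : 1 < s := half_exponent_gt1 theta1.
pose a := comparison_const theta; have a0 : 0 < a := comparison_const_gt0 theta1.
have q10 : 0 <= q - 1 by lra.
have lam0 : 0 <= lam.
  have : 0 < lam * (q - 1) by apply: le_lt_trans qlam; rewrite divr_ge0 ?sqr_ge0.
  by rewrite pmulr_lgt0; [move/ltW|lra].
pose sigma := (s - 1) / s.
have s0 : 0 < s by lra.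
have sig0 : 0 < sigma by rewrite divr_gt0 //; lra.
have sig1 : sigma <= 1 by rewrite ler_pdivrMr //; lra.
(* Large enough for [weight_bounds]. *)
pose m := (Num.truncn (2 * q / sigma)).+1.
have msig : 2 * q <= m%:R * sigma.
  by rewrite -ler_pdivrMr //; apply/ltW/truncnS_gt.
pose k := lam * (q - 1) - q ^+ 2 / 4.
have k0 : 0 < k by rewrite subr_gt0.
pose B := `|q * m.+4.+2%:R / 2 - lam * m.+4.+2%:R|.
pose C1 := m.+4.+2%:R ^+ 2 + 2 * B ^+ 2 / k + 1.
have C10 : 0 <= C1.
  by rewrite !addr_ge0 ?sqr_ge0 // divr_ge0 ?(ltW k0) // mulr_ge0 ?sqr_ge0.
(* The weight of the third field: its term - A v^q g^(m+4) beats the N errors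
   C1 v^q g^(m+4) of the coordinates. *)
pose A := N%:R * C1 + 1.
have A0 : 0 <= A by rewrite addr_ge0 // mulr_ge0.
pose C2 := 8 * ((q - 1) * m.+4%:R * A) ^+ 2 / k + (m.+4%:R * A) ^+ 2.
have C20 : 0 <= C2.
  by rewrite addr_ge0 ?sqr_ge0 // divr_ge0 ?(ltW k0) // mulr_ge0 ?sqr_ge0.
pose k2 := Num.sqrt theta - lam / a.
have k20 : 0 < k2 by rewrite subr_gt0 ltr_pdivrMr // mulrC.
pose E1 := A * (q - 1) / a.
have E10 : 0 <= E1 by rewrite divr_ge0 ?(ltW a0) // mulr_ge0.
pose E2 := N%:R * C2.
have E20 : 0 <= E2 by rewrite mulr_ge0.
have k220 : 0 < k2 / 2 by rewrite divr_gt0.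
have [eps eps0 [Ee Ee2]] := small_eps k220 E10 E20.
pose C := a `^ (- s^-1).
have C0 : 0 <= C by rewrite powR_ge0.
pose D := C / eps.
have D0 : 0 <= D by rewrite divr_ge0 // ltW.
pose K1 := D `^ (q / sigma).
pose K2 := C ^+ 2 * (1 + K1).
have K10 : 0 <= K1 by rewrite powR_ge0.
have K20 : 0 <= K2 by rewrite mulr_ge0 ?sqr_ge0 // addr_ge0.
exists m.+4.+2, (k2 / 2), (E1 / a * K1 + E2 * K2); split => //.
move=> u v sol [z [c [sz sc zc0 Dz Dc]]].
have [su sv uv0 Du Dv] := sol.
have u0 x : 0 < u x by case: (uv0 x).
have v0 x : 0 < v x by case: (uv0 x).
have z0 x : 0 < z x by case: (zc0 x).
have c0 x : 0 < c x by case: (zc0 x).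
have S (f : 'rV[R]_N -> R) i (sf : smooth f) := smooth_C1_along i sf.
have S2 (f : 'rV[R]_N -> R) i (sf : smooth f) := smooth_C1_along i (smooth_partial i sf).
have CF i := C1_along_field q lam A m z0 c0 v0 (S _ i sz) (S2 _ i sz) (S _ i sc)
  (S2 _ i sc) (S _ i su) (S2 _ i su) (S _ i sv) (S2 _ i sv) (C1_along_cutoff i)
  (C1_along_cutoff1 i).
eexists; eexists; split; first exact: CF.
  by move=> i x xi; rewrite /= (cutoff_face xi) !exprS !(mul0r, mulr0, subr0).
move=> x cx.
have g01 := cutoff_bounds cx; have /andP[g0 g1] := g01.
have [rp rC] := ratio_bounds theta1 a0 (u0 x) (v0 x) (comparison x theta1 sol).
have r0 : 0 <= u x / v x by rewrite divr_ge0 // ltW.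
have G0 : 0 <= cutoff x ^+ m by rewrite exprn_ge0.
have Q0 : 0 <= v x `^ q by rewrite powR_ge0.
have n1 : 1 <= m.+4%:R :> R by rewrite ler1n.
pose sumc := 2^-1 * (laplacian z x / z x + laplacian c x / c x) * cutoff x ^+ 6
  - lam * (laplacian v x / v x) * cutoff x ^+ 6
  + A * (laplacian u x / v x) * cutoff x ^+ 4
  - A * (u x / v x) * (q - 1) * (laplacian v x / v x) * cutoff x ^+ 4
  + N%:R * (C1 * cutoff x ^+ 4 + C2 * (u x / v x) ^+ 2).
apply: le_trans (_ : v x `^ q * cutoff x ^+ m * sumc <= _).
  apply: le_trans (ler_sum _ (fun i _ => ler_wpM2l Q0 (coordinate_bound
    (partial i v x / v x) (partial i (partial i v) x / v x)
    (partial i (partial i u) x / v x) (partial i z x / z x)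
    (partial i (partial i z) x / z x) (partial i c x / c x)
    (partial i (partial i c) x / c x)
    A0 r0 g01 (cutoff1_bounds i cx) (cutoff2_bounds i cx) q2 n1 (erefl k) k0
    (erefl B) G0))) _.
  rewrite -mulr_sumr -mulr_sumr mulrA; apply: ler_wpM2l; first exact: mulr_ge0.
  by rewrite sum_coordinates.
apply: le_trans (_ : v x `^ q * cutoff x ^+ m * (- k2 * u x `^ (s - 1) * cutoff x ^+ 6
    - cutoff x ^+ 4 + E1 * (u x / v x * u x `^ (s - 1)) * cutoff x ^+ 4
    + E2 * (u x / v x) ^+ 2) <= _).
  apply: ler_wpM2l; first exact: mulr_ge0.
  have us : u x `^ s = u x `^ (s - 1) * u x.
    by rewrite -[X in _ * X](powRr1 (ltW (u0 x))) -powRDr // subrK.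
  apply: (@divergence_reduction a (Num.sqrt theta) lam (q - 1) A C1 C2 N%:R
    (u x `^ (s - 1)) (u x / v x) _ _ _ _ (c x / z x)) => //.
  - exact: powR_ge0.
  - by rewrite -[laplacian z x]opprK Dz mulNr.
  - exact: divr_gt0.
  - rewrite -[laplacian c x]opprK Dc sqr_sqrtr; last by lra.
    have -> : u x `^ (theta - 1) = u x `^ (s - 1) ^+ 2.
      rewrite -powR_mulrn ?powR_ge0 // -powRrM; congr (_ `^ _).
      by rewrite /s /half_exponent; lra.
    by field; rewrite !gt_eqF.
  - by rewrite -[laplacian u x]opprK Du mulNr divff // gt_eqF.
  - rewrite -[laplacian v x]opprK Dv.
    have -> : u x `^ theta = u x `^ (s - 1) * u x `^ s.
      by rewrite -powRDr //; congr (_ `^ _); rewrite /s /half_exponent; lra.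
    by rewrite us; field; rewrite gt_eqF.
have -> : cutoff x ^+ m.+4.+2 = cutoff x ^+ m * cutoff x ^+ 6 by rewrite -exprD addnC.
apply: (absorption k20 E10 E20 a0 (ltW eps0) (powR_ge0 _ _) r0 _ g01 Ee Ee2 rp K10 K20).
  exact: mulr_ge0.
move=> large; apply: weight_bounds => //; rewrite ?g01 //.
- by lra.
- rewrite ler_pdivlMr //; apply: le_trans (_ : v x `^ sigma * (u x / v x) <= _).
    by rewrite -mulrA ler_wpM2l ?powR_ge0 // mulrC ltW.
  apply: le_trans (ler_wpM2l (powR_ge0 _ _) rC) _.
  by rewrite mulrCA -powRDr // subrr powRr0 mulr1.
Qed.

End Energy.

(** * Nonexistence *)

Section Conclusion.
Context {R : realType} {N : nat}.
Implicit Types (x : 'rV[R]_N) (i : 'I_N).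

Lemma power_unbounded (e X : R) : 0 < e ->
  exists l : nat, X < l.+2%:R `^ e.
Proof.
move=> e0; pose Y := (`|X| + 1) `^ e^-1.
have X1 : 0 < `|X| + 1 by rewrite ltr_wpDl.
have YE : `|X| + 1 = Y `^ e by rewrite -powRrM mulVf ?gt_eqF // powRr1 // ltW.
exists (Num.truncn Y); apply: lt_le_trans (_ : `|X| + 1 <= _).
  by have := ler_norm X; lra.
rewrite YE; apply: ge0_ler_powR; rewrite ?nnegrE ?powR_ge0 ?(ltW e0) //.
by apply: ltW; apply: lt_trans (truncnS_gt _) _; rewrite ltr_nat.
Qed.

Lemma positive_min_on_cube (u v : 'rV[R]_N -> R) (b q : R) :
  continuous u -> continuous v -> (forall x, 0 < u x /\ 0 < v x) ->
  exists2 w, 0 < w & forall x, cube x -> w <= u x `^ b * v x `^ q.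
Proof.
move=> cu cv uv0.
have cp (f : 'rV[R]_N -> R) c : continuous f -> (forall x, 0 < f x) ->
    continuous (fun x => f x `^ c).
  move=> cf f0 x; apply: (@continuous_comp _ _ _ f (fun y : R => y `^ c)).
    exact: cf.
  exact: continuous_at_powR.
have u0 x : 0 < u x by case: (uv0 x).
have v0 x : 0 < v x by case: (uv0 x).
have cw : continuous (fun x => u x `^ b * v x `^ q).
  by move=> x; exact: cvgM (cp _ b cu u0 x) (cp _ q cv v0 x).
have [||x _ xmin] := @compact_EVT_min _ R (fun x => u x `^ b * v x `^ q) cube _
    compact_cube.
- by exists 0 => i; rewrite mxE; lra.
- exact: continuous_subspaceT.
exists (u x `^ b * v x `^ q); first by rewrite mulr_gt0 ?powR_gt0.
by move=> y cy; apply: xmin; rewrite inE.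
Qed.

(** On the corner [0, 1/L]^N the rescaled solution only sees the original one on
    [0, 1]^N, where u^(s-1) v^q has a positive minimum; it picks up the factor
    L^(2 + (4/(theta-1) + 2) q), against the volume factor (2 L)^N. *)
Lemma no_stable_solution (theta q lam : R) : 1 < theta -> 2 <= q ->
  q ^+ 2 / 4 < lam * (q - 1) -> lam < comparison_const theta * Num.sqrt theta ->
  N%:R < 2 + (scaling_exponent theta + 2) * q ->
  ~ exists u v : 'rV[R]_N -> R, positive_solution theta u v /\ stable theta u v.
Proof.
move=> theta1 q2 qlam lama Nq [u [v [sol st]]].
have [su sv uv0 _ _] := sol.
have u0 x : 0 < u x by case: (uv0 x).
have [m [kap [K [kap0 energy]]]] := @energy_field R N _ _ _ theta1 q2 qlam lama.
pose s := half_exponent theta; pose al := scaling_exponent theta.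
have [w w0 wmin] := positive_min_on_cube (s - 1) q (su 0%N) (sv 0%N) uv0.
pose c := kap * (w * (2^-1 ^+ N) ^+ m).
have c0 : 0 < c by rewrite !mulr_gt0 // !exprn_gt0.
have e0 : 0 < 2 + (al + 2) * q - N%:R by rewrite subr_gt0.
have [l Hl] := power_unbounded (K * 2 ^+ N / c) e0.
set L : R := l.+2%:R in Hl.
have L0 : 0 < L by rewrite ltr0n.
have alE : al * (s - 1) = 2.
  rewrite /al /s /scaling_exponent /half_exponent; field; by rewrite subr_eq0 gt_eqF.
have [F [F' [CF F0 divF]]] := energy _ _ (positive_solution_zoom theta1 0 L0 sol)
  (stable_zoom theta1 0 L0 u0 st).
pose g x := kap * (zoom (L `^ al) L 0 u x `^ (s - 1)
  * (zoom (L `^ (al + 2)) L 0 v x `^ q * cutoff x ^+ m)).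
have : c * L `^ (2 + (al + 2) * q) <= K * (2 * L) ^+ N.
  apply: (divergence_bound (G := g) CF F0 divF (l := l.+1)).
    move=> x cx; rewrite /zoom !mulr_ge0 ?powR_ge0 ?exprn_ge0 ?(ltW kap0) //.
    by have /andP[] := cutoff_bounds cx.
  move=> x xL; rewrite /g /zoom add0r.
  have cLx : cube (L *: x).
    move=> i; rewrite mxE; have /andP[x0 x1] := xL i.
    apply/andP; split; first by apply: le_trans (_ : 0 <= _); [lra|rewrite mulr_ge0 // ltW].
    by rewrite mulrC -ler_pdivlMr // div1r.
  have gx : 2^-1 ^+ N <= cutoff x.
    apply: cutoff_corner => i; have /andP[-> x1] := xL i; apply: le_trans x1 _.
    by rewrite lef_pV2 ?posrE ?ltr0n // ler_nat.
  rewrite !powRM ?powR_ge0 ?(ltW (u0 _)) ?(ltW (proj2 (uv0 _))) // -!powRrM.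
  rewrite alE (powRDr 2 _ L0) /c -!mulrA ler_pM2l //.
  have -> : L `^ 2 * (u (L *: x) `^ (s - 1) * (L `^ ((al + 2) * q) *
      (v (L *: x) `^ q * cutoff x ^+ m))) =
     u (L *: x) `^ (s - 1) * v (L *: x) `^ q * (cutoff x ^+ m *
      (L `^ 2 * L `^ ((al + 2) * q))) by ring.
  apply: ler_pM; rewrite ?(ltW w0) ?wmin //; first by rewrite !mulr_ge0 ?powR_ge0 ?exprn_ge0.
  rewrite ler_wpM2r ?mulr_ge0 ?powR_ge0 // lerXn2r ?nnegrE ?exprn_ge0 //.
  exact: le_trans gx.
apply/negP; rewrite -ltNge exprMn -[L ^+ N]powR_mulrn ?(ltW L0) //.
move: Hl; rewrite ltr_pdivrMr // => Hl.
have -> : 2 + (al + 2) * q = (2 + (al + 2) * q - N%:R) + N%:R by rewrite subrK.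
rewrite (powRDr _ N%:R L0) !mulrA ltr_pM2r ?powR_gt0 //.
by rewrite [ltRHS]mulrC.
Qed.

End Conclusion.

Section Exponents.
Context {R : realType}.

Lemma sqrt_zparam (theta : R) : 1 < theta ->
  comparison_const theta * Num.sqrt theta = Num.sqrt (zparam theta).
Proof.
move=> theta1; have s1 := half_exponent_gt1 theta1.
rewrite /comparison_const -sqrtrV; last by lra.
rewrite -sqrtrM ?invr_ge0; last by lra.
by congr Num.sqrt; rewrite /zparam /half_exponent; field; rewrite gt_eqF //; lra.
Qed.

Lemma sqrt_zparam_bounds (theta : R) : 1 < theta ->
  1 < Num.sqrt (zparam theta) /\ Num.sqrt (zparam theta) ^+ 2 = zparam theta.
Proof.
move=> theta1; have z1 : 1 < zparam theta.
  by rewrite /zparam ltr_pdivlMr; lra.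
split; last by rewrite sqr_sqrtr //; lra.
by rewrite -{1}[1]sqrtr1 ltr_sqrt //; lra.
Qed.

(** With y = sqrt z, the condition t^2/(2t-1) < y reads (t-y)^2 < y^2 - y, and
    t_0^+ is the larger root; any t strictly between y and t_0^+ that also
    satisfies the dimension condition will do, q being 2 t. *)
Lemma exponent_choice (theta X : R) : 1 < theta ->
  X < 2 + 4 * (theta + 1) / (theta - 1) * t0plus theta ->
  exists q lam : R, [/\ 2 <= q, q ^+ 2 / 4 < lam * (q - 1),
    lam < comparison_const theta * Num.sqrt theta
    & X < 2 + (scaling_exponent theta + 2) * q].
Proof.
move=> theta1; rewrite /t0plus sqrt_zparam //.
have [] := sqrt_zparam_bounds theta1.
move: (Num.sqrt (zparam theta)) => y y1 <-.
have w0 : 0 < y ^+ 2 - y by nra.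
have ww : Num.sqrt (y ^+ 2 - y) ^+ 2 = y ^+ 2 - y by rewrite sqr_sqrtr // ltW.
have sw0 : 0 < Num.sqrt (y ^+ 2 - y) by rewrite sqrtr_gt0.
move: (Num.sqrt _) ww sw0 => w ww sw0.
set b := 4 * (theta + 1) / (theta - 1) => Xb.
have b0 : 0 < b by rewrite divr_gt0 ?mulr_gt0; lra.
have Xt : (X - 2) / b < y + w by rewrite ltr_pdivrMr // mulrC; lra.
pose t := (Num.max y ((X - 2) / b) + (y + w)) / 2.
have yt : y < t.
  have : y <= Num.max y ((X - 2) / b) by rewrite le_max lexx.
  by rewrite /t; lra.
have mt0 : Num.max y ((X - 2) / b) < y + w by rewrite gt_max Xt andbT; lra.
have tt0 : t < y + w by rewrite /t; lra.
have Xbt : (X - 2) / b < t.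
  have : (X - 2) / b <= Num.max y ((X - 2) / b) by rewrite le_max lexx orbT.
  by rewrite /t; lra.
have t2 : 0 < 2 * t - 1 by lra.
have key : t ^+ 2 / (2 * t - 1) < y.
  rewrite ltr_pdivrMr //; have : 0 < (w - (t - y)) * (w + (t - y)).
    by apply: mulr_gt0; lra.
  have -> : (w - (t - y)) * (w + (t - y)) = w ^+ 2 - (t - y) ^+ 2 by ring.
  by rewrite ww; lra.
exists (2 * t), ((t ^+ 2 / (2 * t - 1) + y) / 2); split; [lra| |lra|].
  rewrite -ltr_pdivrMr // (_ : (2 * t) ^+ 2 / 4 = t ^+ 2); last by field.
  by lra.
have -> : (scaling_exponent theta + 2) * (2 * t) = b * t.
  by rewrite /scaling_exponent /b; field; rewrite subr_eq0 gt_eqF.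
by move: Xbt; rewrite ltr_pdivrMr // mulrC; lra.
Qed.

(** Here (theta+1)/(theta-1) = 1/(z-1).  With sqrt z = 1 + d and d < 42/100 the
    claim is 2 (2 d + d^2) < 1 + d + sqrt (d + d^2), which follows from
    sqrt (d + d^2) >= 9/5 d. *)
Lemma dimension_ten (theta : R) : 1 < theta ->
  10 < 2 + 4 * (theta + 1) / (theta - 1) * t0plus theta.
Proof.
move=> theta1; rewrite /t0plus.
have [y1 yy] := sqrt_zparam_bounds theta1.
have zE : (zparam theta - 1) * (theta + 1) = theta - 1.
  by rewrite /zparam; field; rewrite gt_eqF //; lra.
have z2 : zparam theta < 2 by rewrite /zparam ltr_pdivrMr; lra.
have tp : 0 < theta + 1 by lra.
have tm : 0 < theta - 1 by lra.
have bE : 4 * (theta + 1) / (theta - 1) = 4 / (zparam theta - 1).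
  by rewrite -zE; field; rewrite !gt_eqF //; nra.
rewrite bE; move: (Num.sqrt (zparam theta)) yy y1 => y yy y1; rewrite -yy in z2 *.
have [d yd] : exists d, y = 1 + d by exists (y - 1); lra.
rewrite {y yy}yd in y1 z2 *.
have d0 : 0 < d by lra.
have d1 : d < 42 / 100 by rewrite ltNge; apply/negP => ?; nra.
have w1 : 9 / 5 * d <= Num.sqrt ((1 + d) ^+ 2 - (1 + d)).
  have -> : 9 / 5 * d = Num.sqrt ((9 / 5 * d) ^+ 2).
    by rewrite sqrtr_sqr ger0_norm //; lra.
  by apply: ler_wsqrtr; nra.
have y21 : 0 < (1 + d) ^+ 2 - 1 by nra.
rewrite -ltrBlDl mulrAC ltr_pdivlMr //.
have dd : d ^+ 2 <= 42 / 100 * d by rewrite expr2 ler_wpM2r // ltW.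
by lra.
Qed.

End Exponents.

Theorem theorem2 (R : realType) (N : nat) (hN : (1 <= N)%N) :
  (forall theta : R, 1 < theta ->
     N%:R < 2 + 4 * (theta + 1) / (theta - 1) * t0plus theta ->
     ~ exists u v : 'rV[R]_N -> R,
         positive_solution theta u v /\ stable theta u v)
  /\
  ((N <= 10)%N ->
   forall theta : R, 1 < theta ->
     ~ exists u v : 'rV[R]_N -> R,
         positive_solution theta u v /\ stable theta u v).
Proof.
have noN (theta : R) : 1 < theta ->
    N%:R < 2 + 4 * (theta + 1) / (theta - 1) * t0plus theta ->
    ~ exists u v : 'rV[R]_N -> R, positive_solution theta u v /\ stable theta u v.
  move=> theta1 /(exponent_choice theta1)[q [lam [q2 qlam lama Nq]]].
  exact: no_stable_solution theta1 q2 qlam lama Nq.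
split=> // N10 theta theta1; apply: noN => //.
by apply: le_lt_trans (dimension_ten theta1); rewrite ler_nat.
Qed.
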